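(* Let $p$ be a prime. For each $\alpha\ge\log p$, the set $$\left\{x\in p\mathbb{Z}_p\setminus F:\ -\lim_{n\to\infty}\frac1n\log\left|x-\frac{p_n(x)}{q_n(x)}\right|_p=\alpha\right\}$$ has Hausdorff dimension $$\frac{\log(p-1)+\log(\alpha-\log p)-\log\log p+\alpha\log_p\alpha-\alpha\log_p(\alpha-\log p)}{\alpha},$$ where for $\alpha=\log p$ this expression is interpreted as its limit as $\alpha\downarrow\log p$, namely $\frac{\log(p-1)}{\log p}$.
   Context: $\log$ is the natural logarithm and $\log_p x=\log x/\log p$. $\mathbb{Q}_p$ is the field of $p$-adic numbers with valuation $v_p$ and absolute value $|x|_p=p^{-v_p(x)}$, and $p\mathbb{Z}_p=\{x\in\mathbb{Q}_p:|x|_p<1\}$. The Schneider map $T_p:p\mathbb{Z}_p\to p\mathbb{Z}_p$ is $T_p(0)=0$ and, for $x\ne0$, $T_p(x)=\frac{p^{a_1(x)}}{x}-b_1(x)$, where $a_1(x)=v_p(x)$ and $b_1(x)\in\{1,\dots,p-1\}$ is determined by $b_1(x)\equiv p^{a_1(x)}/x \pmod p$. Let $F=\bigcup_{k\ge0}T_p^{-k}(0)$, and for $x\in p\mathbb{Z}_p\setminus F$, $i\ge1$, let $a_i(x)=a_1(T_p^{i-1}x)$, $b_i(x)=b_1(T_p^{i-1}x)$. The $n$-th rational approximation of $x\in p\mathbb{Z}_p\setminus F$ is the truncated Schneider continued fraction $$\frac{p_n(x)}{q_n(x)}=\cfrac{p^{a_1(x)}}{b_1(x)+\cfrac{p^{a_2(x)}}{b_2(x)+\cdots+\cfrac{p^{a_n(x)}}{b_n(x)}}}.$$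 Hausdorff dimension is taken with respect to the $p$-adic metric. *)

(* Defs.v *)
From HB Require Import structures.
From mathcomp Require Import all_boot all_order all_algebra.
From mathcomp Require Import generic_quotient.
From mathcomp Require Import all_classical all_reals all_analysis.

Set Implicit Arguments.
Unset Strict Implicit.
Unset Printing Implicit Defensive.

Import Order.TTheory GRing.Theory Num.Theory.
Import numFieldNormedType.Exports.
Local Open Scope ring_scope.

(* The ring Z_p as the inverse limit of the rings Z/p^n.  The n-th term of a
   p-adic integer is its residue modulo p ^ n, represented in [0, p ^ n[ (the
   coherence condition forces this range); equality is thus termwise. *)
Record padic_int (p : nat) (p_pr : prime p) := PadicInt {
  residue :> nat -> int;
  _ : `[< forall n, residue n = (residue n.+1 %% (p ^ n)%N)%Z >] }.

Section PadicInt.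
Variables (p : nat) (p_pr : prime p).
Local Notation Zp := (padic_int p_pr).

HB.instance Definition _ := [isSub for @residue p p_pr].
HB.instance Definition _ := [Choice of Zp by <:].

Lemma residueS (x : Zp) n : x n = (x n.+1 %% (p ^ n)%N)%Z.
Proof. by case: x => x /= /asboolP. Qed.

Lemma residue_mod (x : Zp) n : (x n %% (p ^ n)%N)%Z = x n.
Proof. by rewrite residueS modz_mod. Qed.

Lemma padic_intP (x y : Zp) : x = y <-> forall n, x n = y n.
Proof. by split=> [-> //|xy]; apply/val_inj/funext. Qed.

Lemma modz_mod_dvd (a m n : int) : (m %| n)%Z -> ((a %% n)%Z %% m)%Z = (a %% m)%Z.
Proof. by move=> /dvdzP[k ->]; rewrite {2}(divz_eq a (k * m)) mulrA modzMDl. Qed.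

Lemma dvd_pX n k : ((p ^ n)%N%:Z %| (p ^ (k + n))%N%:Z)%Z.
Proof. by rewrite dvdzE /= dvdn_exp2l ?leq_addl. Qed.

Lemma residueD (x : Zp) k n : x n = (x (k + n)%N %% (p ^ n)%N)%Z.
Proof.
elim: k => [|k IH]; first by rewrite residue_mod.
by rewrite IH addSn [x (k + n)%N]residueS modz_mod_dvd ?dvd_pX.
Qed.

(* the p-adic integer of residues f n, for f coherent up to reduction *)
Fact mk_proof (f : nat -> int) :
  (forall n, (f n %% (p ^ n)%N)%Z = (f n.+1 %% (p ^ n)%N)%Z) ->
  `[< forall n, (f n %% (p ^ n)%N)%Z
        = ((f n.+1 %% (p ^ n.+1)%N)%Z %% (p ^ n)%N)%Z >].
Proof. by move=> fP; apply/asboolP => n; rewrite modz_mod_dvd ?(dvd_pX n 1). Qed.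

Definition mk_padic_int f fP : Zp :=
  @PadicInt p p_pr (fun n => (f n %% (p ^ n)%N)%Z) (@mk_proof f fP).

Fact const_coherent (a : int) n : (a %% (p ^ n)%N)%Z = (a %% (p ^ n)%N)%Z.
Proof. by []. Qed.
Definition padic_int_of (a : int) : Zp := mk_padic_int (const_coherent a).

Fact opp_coherent (x : Zp) n :
  ((- x n) %% (p ^ n)%N)%Z = ((- x n.+1) %% (p ^ n)%N)%Z.
Proof. by rewrite residueS modzNm. Qed.
Definition padic_int_opp x := mk_padic_int (opp_coherent x).

Fact add_coherent (x y : Zp) n :
  ((x n + y n) %% (p ^ n)%N)%Z = ((x n.+1 + y n.+1) %% (p ^ n)%N)%Z.
Proof. by rewrite !(residueS _ n) modzDm. Qed.
Definition padic_int_add x y := mk_padic_int (add_coherent x y).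

Fact mul_coherent (x y : Zp) n :
  ((x n * y n) %% (p ^ n)%N)%Z = ((x n.+1 * y n.+1) %% (p ^ n)%N)%Z.
Proof. by rewrite !(residueS _ n) modzMm. Qed.
Definition padic_int_mul x y := mk_padic_int (mul_coherent x y).

Fact padic_int_addA : associative padic_int_add.
Proof. by move=> x y z; apply/padic_intP => n /=; rewrite modzDml modzDmr addrA. Qed.
Fact padic_int_addC : commutative padic_int_add.
Proof. by move=> x y; apply/padic_intP => n /=; rewrite addrC. Qed.
Fact padic_int_add0 : left_id (padic_int_of 0) padic_int_add.
Proof. by move=> x; apply/padic_intP => n /=; rewrite mod0z add0r residue_mod. Qed.
Fact padic_int_addN : left_inverse (padic_int_of 0) padic_int_opp padic_int_add.
Proof. by move=> x; apply/padic_intP => n /=; rewrite modzDml addNr. Qed.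
HB.instance Definition _ := GRing.isZmodule.Build Zp
  padic_int_addA padic_int_addC padic_int_add0 padic_int_addN.

Fact padic_int_mulA : associative padic_int_mul.
Proof. by move=> x y z; apply/padic_intP => n /=; rewrite modzMml modzMmr mulrA. Qed.
Fact padic_int_mulC : commutative padic_int_mul.
Proof. by move=> x y; apply/padic_intP => n /=; rewrite mulrC. Qed.
Fact padic_int_mul1 : left_id (padic_int_of 1) padic_int_mul.
Proof. by move=> x; apply/padic_intP => n /=; rewrite modzMml mul1r residue_mod. Qed.
Fact padic_int_mulD : left_distributive padic_int_mul padic_int_add.
Proof.
by move=> x y z; apply/padic_intP => n /=; rewrite modzMml modzDm mulrDl.
Qed.
Fact padic_int_1neq0 : padic_int_of 1 != 0.
Proof.
apply/eqP => /padic_intP /(_ 1) /=; rewrite expn1 mod0z modz_small //=.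
by rewrite ltz_nat prime_gt1.
Qed.
HB.instance Definition _ := GRing.Zmodule_isComNzRing.Build Zp
  padic_int_mulA padic_int_mulC padic_int_mul1 padic_int_mulD padic_int_1neq0.

Definition padic_int_unit : pred Zp := fun x => `[< exists y : Zp, y * x = 1 >].
Definition padic_int_inv (x : Zp) : Zp :=
  if pselect (exists y : Zp, y * x = 1) is left h then sval (cid h) else x.
Fact padic_int_mulV : {in padic_int_unit, left_inverse 1 padic_int_inv *%R}.
Proof.
move=> x /asboolP ux; rewrite /padic_int_inv; case: pselect => // h.
by case: cid.
Qed.
Fact padic_int_unitP (x y : Zp) : y * x = 1 -> padic_int_unit x.
Proof. by move=> yx; apply/asboolP; exists y. Qed.
Fact padic_int_inv_out : {in [predC padic_int_unit], padic_int_inv =1 id}.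
Proof.
move=> x; rewrite !inE => /asboolPn ux; rewrite /padic_int_inv.
by case: pselect.
Qed.
HB.instance Definition _ := GRing.ComNzRing_hasMulInverse.Build Zp
  padic_int_mulV padic_int_unitP padic_int_inv_out.

Lemma residue0 n : (0 : Zp) n = 0.
Proof. by rewrite /= mod0z. Qed.
Lemma residueN (x : Zp) n : (- x : Zp) n = (- x n %% (p ^ n)%N)%Z.
Proof. by []. Qed.
Lemma residue1 n : (1 : Zp) n = (1 %% (p ^ n)%N)%Z.
Proof. by []. Qed.
Lemma residue_add (x y : Zp) n : (x + y : Zp) n = ((x n + y n) %% (p ^ n)%N)%Z.
Proof. by []. Qed.
Lemma residue_mul (x y : Zp) n : (x * y : Zp) n = ((x n * y n) %% (p ^ n)%N)%Z.
Proof. by []. Qed.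

Lemma padic_int_neq0 (x : Zp) : x != 0 -> exists n, x n.+1 != 0.
Proof.
apply: contra_neqP => /forallNP x0; apply/padic_intP => n.
rewrite residueS residue0; have /negP := x0 n.
by rewrite negbK => /eqP ->; rewrite mod0z.
Qed.

(* for x != 0, the largest n such that x = 0 modulo p ^ n *)
Definition padic_int_val (x : Zp) : nat :=
  if pselect (exists n, x n.+1 != 0) is left h then ex_minn h else 0.

Lemma padic_int_valP (x : Zp) n : x != 0 ->
  (x n == 0) = (n <= padic_int_val x)%N.
Proof.
move=> /padic_int_neq0 x0; rewrite /padic_int_val; case: pselect => // h.
case: ex_minnP => m xm mmin; apply/idP/idP => [xn|nm].
  rewrite leqNgt; apply: contra xm => mn.
  by rewrite (residueD _ (n - m.+1)) subnK // (eqP xn) mod0z.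
case: n nm => [|n nm]; first by rewrite residueS expn0 modz1.
by apply: contraLR nm => /mmin; rewrite -leqNgt.
Qed.

Lemma residue_factor (x : Zp) n : x != 0 -> (padic_int_val x <= n)%N ->
  exists2 c, x n.+1 = c * (p ^ padic_int_val x)%N%:Z & ~~ (p%:Z %| c)%Z.
Proof.
move=> x0 xn; set v := padic_int_val x.
have /dvdzP[c xc] : ((p ^ v)%N%:Z %| x n.+1)%Z.
  apply/dvdz_mod0P; apply/eqP.
  have := residueD x (n.+1 - v) v; rewrite subnK ?(leq_trans xn) // => <-.
  by rewrite padic_int_valP.
exists c => //; apply/negP => /dvdzP[d cd].
have : (x v.+1 == 0); last by rewrite padic_int_valP // ltnn.
have := residueD x (n - v) v.+1; rewrite addnS subnK // => ->.
by rewrite xc cd -mulrA -PoszM -expnS modzMl.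
Qed.

Lemma residue_mul_val (x y : Zp) : x != 0 -> y != 0 ->
  let n := (padic_int_val x + padic_int_val y)%N in
  (x * y : Zp) n = 0 /\ (x * y : Zp) n.+1 != 0.
Proof.
move=> x0 y0 n.
have [c xc pc] := residue_factor x0 (leq_addr (padic_int_val y) _).
have [d yd pd] := residue_factor y0 (leq_addl (padic_int_val x) _).
have xyE : x n.+1 * y n.+1 = c * d * (p ^ n)%N%:Z.
  by rewrite xc yd mulrACA -PoszM -expnD.
rewrite [(x * y : Zp) n]residueS !residue_mul xyE; split.
  by rewrite modz_mod_dvd ?(dvd_pX n 1) // modzMl.
have q0 : (p ^ n)%N%:Z != 0 by rewrite eqz_nat -lt0n expn_gt0 prime_gt0.
apply/eqP => /dvdz_mod0P; rewrite expnS PoszM dvdz_mul2r //.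
by rewrite dvdzE abszM Euclid_dvdM // -!dvdzE (negbTE pc) (negbTE pd).
Qed.

Fact padic_int_integral : GRing.integral_domain_axiom Zp.
Proof.
move=> x y xy0; apply/norP => -[x0 y0].
by have [_] := residue_mul_val x0 y0; rewrite xy0 residue0 eqxx.
Qed.
HB.instance Definition _ :=
  GRing.ComUnitRing_isIntegral.Build Zp padic_int_integral.

Lemma padic_int_valM (x y : Zp) : x != 0 -> y != 0 ->
  padic_int_val (x * y) = (padic_int_val x + padic_int_val y)%N.
Proof.
move=> x0 y0; have xy0 : x * y != 0 by rewrite mulf_neq0.
have [/eqP xyn xynS] := residue_mul_val x0 y0.
apply/eqP; rewrite eqn_leq -[X in _ && X]padic_int_valP // xyn andbT.
by rewrite leqNgt -padic_int_valP.
Qed.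

End PadicInt.

Definition padic (p : nat) (p_pr : prime p) : Type :=
  {fraction (padic_int p_pr)}.

(* The field structure is that of {fraction (padic_int p_pr)}, but with an
   opaque boolean equality: unfolding the one of the quotient makes conversion
   diverge in practice. *)
Section PadicField.
Variables (p : nat) (p_pr : prime p).
Local Notation Zp := (padic_int p_pr).
Local Notation Qp := (padic p_pr).
Local Notation F := {fraction Zp}.

HB.instance Definition _ := gen_eqMixin Qp.
HB.instance Definition _ := gen_choiceMixin Qp.
HB.instance Definition _ := GRing.isZmodule.Build Qp
  (@addrA F) (@addrC F) (@add0r F) (@addNr F).

Fact padic_1neq0 : (1 : F) != 0 :> Qp.
Proof. by apply/eqP => e; have /eqP := oner_neq0 F; apply. Qed.
HB.instance Definition _ := GRing.Zmodule_isComNzRing.Build Qp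
  (@mulrA F) (@mulrC F) (@mul1r F) (@mulrDl F) padic_1neq0.

Definition padic_inv : Qp -> Qp := @GRing.inv F.
Fact padic_mulVx (x : Qp) : x != 0 -> padic_inv x * x = 1.
Proof. by move=> x0; apply: (@mulVf F); apply/eqP => xE; case/eqP: x0. Qed.
Fact padic_inv0 : padic_inv 0 = 0. Proof. exact: (@invr0 F). Qed.
HB.instance Definition _ :=
  GRing.ComNzRing_isField.Build Qp padic_mulVx padic_inv0.

Definition padic_of_int : Zp -> Qp := @FracField.tofrac Zp.
Fact padic_of_int_zmod : zmod_morphism padic_of_int.
Proof. exact: tofrac_is_zmod_morphism. Qed.
Fact padic_of_int_monoid : monoid_morphism padic_of_int.
Proof. exact: tofrac_is_monoid_morphism. Qed.
HB.instance Definition _ :=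
  GRing.isZmodMorphism.Build Zp Qp padic_of_int padic_of_int_zmod.
HB.instance Definition _ :=
  GRing.isMonoidMorphism.Build Zp Qp padic_of_int padic_of_int_monoid.

Lemma padic_of_int_eq (a b : Zp) :
  (padic_of_int a == padic_of_int b) = (a == b).
Proof.
apply/eqP/eqP => [ab|-> //]; apply/eqP; rewrite -tofrac_eq; exact/eqP.
Qed.

Lemma padic_of_int_eq0 (a : Zp) : (padic_of_int a == 0) = (a == 0).
Proof. by rewrite -(rmorph0 padic_of_int) padic_of_int_eq. Qed.

Lemma padic_frac (x : Qp) (f := frac (repr (x : F))) :
  x = padic_of_int f.1 / padic_of_int f.2.
Proof.
have d0 : padic_of_int f.2 != 0 by rewrite padic_of_int_eq0 denom_ratioP.
apply: (mulIf d0); rewrite divfK //.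
rewrite -[x](@reprK _ F) /padic_of_int; unlock FracField.tofrac.
rewrite -[LHS]FracField.pi_mul; apply/eqmodP => /=.
rewrite FracField.equivfE /FracField.mulf.
rewrite !numden_Ratio ?mulf_neq0 ?oner_neq0 ?denom_ratioP //.
by rewrite !mulr1 mulrC.
Qed.

End PadicField.

(* v_p(a / b) = v_p(a) - v_p(b), which does not depend on the representative
   (padic_val_frac); v_p(0) has the junk value 0 *)
HB.lock Definition padic_val (p : nat) (p_pr : prime p) (x : padic p_pr) : int :=
  if x == 0 then 0 else
  let f := frac (repr (x : {fraction (padic_int p_pr)})) in
  (padic_int_val f.1)%:Z - (padic_int_val f.2)%:Z.

Section Padic.
Variables (p : nat) (p_pr : prime p).
Local Notation Zp := (padic_int p_pr).
Local Notation Qp := (padic p_pr).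
Local Notation "x %:F" := (padic_of_int x).

Definition padic_abs (R : numFieldType) (x : Qp) : R :=
  if x == 0 then 0 else p%:R ^ (- padic_val x).

Definition padic_dist (R : numFieldType) (x y : Qp) : R := padic_abs R (x - y).

Lemma padic_val_frac (a b : Zp) : a != 0 -> b != 0 ->
  padic_val (a%:F / b%:F : Qp) = (padic_int_val a)%:Z - (padic_int_val b)%:Z.
Proof.
move=> a0 b0; set x : Qp := a%:F / b%:F.
have x0 : x != 0 by rewrite mulf_neq0 ?invr_neq0 ?padic_of_int_eq0.
rewrite padic_val.unlock (negbTE x0) /=.
have := padic_frac x; set f := repr _ => xE.
have d0 : (frac f).2 != 0 by rewrite denom_ratioP.
have n0 : (frac f).1 != 0.
  by apply: contraNneq x0 => n0; rewrite xE n0 rmorph0 mul0r.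
have /eqP : x = (frac f).1%:F / (frac f).2%:F by [].
rewrite eqr_div ?padic_of_int_eq0 // -!rmorphM padic_of_int_eq => /eqP.
move=> /(congr1 (@padic_int_val p p_pr)); rewrite !padic_int_valM // => vE.
apply/eqP; rewrite subr_eq addrAC eq_sym subr_eq -!PoszD eqz_nat.
by rewrite vE addnC.
Qed.

Lemma padic_fracP (x : Qp) : x != 0 ->
  exists a b : Zp, [/\ a != 0, b != 0 & x = a%:F / b%:F].
Proof.
move=> x0; exists (frac (repr (x : {fraction Zp}))).1.
exists (frac (repr (x : {fraction Zp}))).2; split.
- by apply: contraNneq x0 => n0; rewrite (padic_frac x) n0 rmorph0 mul0r.
- by rewrite denom_ratioP.
- exact: padic_frac.
Qed.

Lemma padic_valM (x y : Qp) : x != 0 -> y != 0 ->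
  padic_val (x * y) = padic_val x + padic_val y.
Proof.
move=> /padic_fracP[a [b [a0 b0 ->]]] /padic_fracP[c [e [c0 e0 ->]]].
rewrite mulf_div -!rmorphM !padic_val_frac ?mulf_neq0 // !padic_int_valM //.
by rewrite !PoszD opprD addrACA.
Qed.

Lemma padic_int_nat n k : (n%:R : Zp) k = (n %% p ^ k)%N%:Z.
Proof.
elim: n => [|n IH]; first by rewrite residue0 mod0n.
by rewrite -natr1 residue_add IH residue1 -!modz_nat modzDm -PoszD addn1.
Qed.

Lemma padic_int_residue_p n : ((p%:R : Zp) n == 0) = (n <= 1)%N.
Proof.
rewrite padic_int_nat eqz_nat -/(dvdn _ _) -[X in (_ %| X)%N]expn1.
by rewrite dvdn_Pexp2l ?prime_gt1.
Qed.

Lemma padic_int_p_neq0 : (p%:R : Zp) != 0.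
Proof.
by apply: contraFneq (padic_int_residue_p 2) => ->; rewrite residue0.
Qed.

Lemma padic_int_val_p : padic_int_val (p%:R : Zp) = 1%N.
Proof.
have p0 := padic_int_p_neq0; apply/eqP; rewrite eqn_leq.
rewrite -[X in _ && X]padic_int_valP // padic_int_residue_p andbT.
by rewrite leqNgt -padic_int_valP // padic_int_residue_p.
Qed.

Lemma padic_int_val1 : padic_int_val (1 : Zp) = 0%N.
Proof.
have := padic_int_valM (oner_neq0 Zp) (oner_neq0 Zp).
by rewrite mulr1 => /eqP; rewrite -{1}[padic_int_val 1]addn0 eqn_add2l => /eqP.
Qed.

Lemma padic_p_neq0 : (p%:R : Qp) != 0.
Proof.
by rewrite -(rmorph_nat (@padic_of_int p p_pr)) padic_of_int_eq0 padic_int_p_neq0.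
Qed.

Lemma padic_val_int (a : Zp) : a != 0 -> padic_val (a%:F : Qp) = padic_int_val a.
Proof.
move=> a0; rewrite -[a%:F]divr1 -(rmorph1 (@padic_of_int p p_pr)) padic_val_frac ?oner_neq0 //.
by rewrite padic_int_val1 subr0.
Qed.

Lemma padic_val1 : padic_val (1 : Qp) = 0.
Proof. by rewrite -(rmorph1 (@padic_of_int p p_pr)) padic_val_int ?oner_neq0 // padic_int_val1. Qed.

Lemma padic_val_p : padic_val (p%:R : Qp) = 1.
Proof.
rewrite -(rmorph_nat (@padic_of_int p p_pr)) padic_val_int ?padic_int_p_neq0 //.
by rewrite padic_int_val_p.
Qed.

Lemma padic_valV (x : Qp) : x != 0 -> padic_val x^-1 = - padic_val x.
Proof.
move=> x0; apply/eqP; rewrite -addr_eq0 -padic_valM ?invr_neq0 //.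
by rewrite mulVf // padic_val1.
Qed.

Lemma padic_val_pX (k : int) : padic_val ((p%:R : Qp) ^ k) = k.
Proof.
have p0 := padic_p_neq0.
have nat_case n : padic_val ((p%:R : Qp) ^+ n) = n%:Z.
  elim: n => [|n IH]; first by rewrite expr0 padic_val1.
  by rewrite exprS padic_valM ?expf_neq0 // IH padic_val_p.
case: k => n; first exact: nat_case.
by rewrite NegzE -exprnN padic_valV ?expf_neq0 // nat_case.
Qed.

Local Open Scope classical_set_scope.

(* pZ_p; congruence modulo p means that the difference lies in this set *)
Definition padic_max_ideal : set Qp := [set x : Qp | padic_abs rat x < 1].

Lemma padic_max_idealP (x : Qp) :
  padic_max_ideal x <-> x = 0 \/ (0 < padic_val x)%R.
Proof.
have p1 : (1 < p%:R :> rat)%R by rewrite ltr1n prime_gt1.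
rewrite /padic_max_ideal /padic_abs /=; case: eqVneq => [->|x0].
  by split=> // _; left.
rewrite -[X in _ < X](expr0z (p%:R : rat)) ltr_eXz2l // oppr_lt0.
by split=> [|[/eqP|//]]; [right|rewrite (negbTE x0)].
Qed.

Lemma padic_max_ideal_frac (a b : Zp) : b != 0 ->
  padic_max_ideal (a%:F / b%:F) <-> a (padic_int_val b).+1 = 0.
Proof.
move=> b0; case: (eqVneq a 0) => [->|a0].
  by rewrite rmorph0 mul0r residue0 padic_max_idealP; split=> // _; left.
rewrite padic_max_idealP padic_val_frac // subr_gt0 ltz_nat.
rewrite -[(_ < _)%N]padic_int_valP //; split=> [[/eqP|/eqP //]|->]; last by right.
by rewrite mulf_eq0 invr_eq0 !padic_of_int_eq0 (negbTE a0) (negbTE b0).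
Qed.

Lemma padic_digit (x : Qp) : x != 0 -> padic_val x = 0 ->
  exists! b, (0 < b < p)%N /\ padic_max_ideal (x - b%:R).
Proof.
move=> /padic_fracP[a [b [a0 b0 ->]]]; rewrite padic_val_frac //.
move=> /eqP; rewrite subr_eq0 eqz_nat => /eqP abv; set v := padic_int_val b.
have [c ac pc] := residue_factor a0 (leqnn _).
have [d bd pd] := residue_factor b0 (leqnn _); rewrite abv -/v in ac bd.
have q0 : (p ^ v)%N%:Z != 0 by rewrite eqz_nat -lt0n expn_gt0 prime_gt0.
have idealE m : padic_max_ideal (a%:F / b%:F - m%:R) <-> (p%:Z %| c - m%:Z * d)%Z.
  have -> : a%:F / b%:F - m%:R = (a - m%:R * b)%:F / b%:F.
    by rewrite rmorphB rmorphM rmorph_nat mulrBl mulfK ?padic_of_int_eq0.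
  rewrite padic_max_ideal_frac // -/v residue_add residueN residue_mul.
  rewrite padic_int_nat -modz_nat modzMml modzNm modzDmr ac bd.
  rewrite mulrA -mulrBl expnS PoszM; split=> [/dvdz_mod0P|].
    by rewrite dvdz_mul2r.
  by move=> h; apply/dvdz_mod0P; rewrite dvdz_mul2r.
have pcop : coprimez d p.
  by rewrite coprimez_sym coprimezE prime_coprime // -dvdzE.
have /coprimezP[[u w] /= uw] := pcop.
have p0 : p%:Z != 0 by rewrite eqz_nat -lt0n prime_gt0.
pose m := `|((c * u) %% p)%Z|%N.
have mE : m%:Z = ((c * u) %% p)%Z by rewrite /m gez0_abs ?modz_ge0.
have mP : (p%:Z %| c - m%:Z * d)%Z.
  rewrite mE -eqz_mod_dvd; apply/eqP; rewrite modzMml -mulrA.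
  have -> : u * d = 1 - w * p by rewrite -uw addrK.
  by rewrite mulrBr mulr1 mulrA -mulNr addrC modzMDl.
have mp : (m < p)%N by rewrite -ltz_nat mE ltz_pmod ?ltz_nat ?prime_gt0.
exists m; split.
  split; last exact/idealE.
  rewrite mp andbT lt0n.
  by apply: contra pc => /eqP m0; move: mP; rewrite m0 mul0r subr0.
move=> m' [/andP[m'0 m'p] /idealE m'P].
have : (p%:Z %| (m%:Z - m'%:Z) * d)%Z.
  have -> : (m%:Z - m'%:Z) * d = (c - m'%:Z * d) - (c - m%:Z * d).
    by rewrite mulrBl opprB [RHS]addrC addrA subrK.
  exact: rpredB.
rewrite dvdzE abszM Euclid_dvdM // -!dvdzE (negbTE pd) orbF -eqz_mod_dvd.
by rewrite !modz_nat !modn_small // => /eqP[].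
Qed.

(* a_1(x) = v_p(x), for x != 0 *)
Definition schneider_exp (x : Qp) : int := padic_val x.

(* b_1(x), for x != 0: the b in {1, ..., p - 1} congruent to p^a_1(x) / x
   modulo p, which is unique (padic_digit, schneider_digitP) *)
Definition schneider_digit (x : Qp) : nat :=
  xget 0%N [set b : nat | (0 < b < p)%N /\
    padic_max_ideal (p%:R ^ schneider_exp x / x - b%:R)].

Lemma schneider_digitP (x : Qp) : x != 0 ->
  (0 < schneider_digit x < p)%N /\
  padic_max_ideal (p%:R ^ schneider_exp x / x - (schneider_digit x)%:R).
Proof.
move=> x0; have pX0 : (p%:R : Qp) ^ schneider_exp x != 0.
  by rewrite expfz_neq0 ?padic_p_neq0.
have [||b [bP _]] := @padic_digit (p%:R ^ schneider_exp x / x).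
- by apply: mulf_neq0 pX0 _; rewrite invr_eq0.
- by rewrite padic_valM ?invr_neq0 // padic_valV // padic_val_pX subrr.
by rewrite /schneider_digit; case: xgetP => [_ -> //|/(_ b)].
Qed.

Definition schneider_map (x : Qp) : Qp :=
  if x == 0 then 0 else p%:R ^ schneider_exp x / x - (schneider_digit x)%:R.

Lemma schneider_map_max_ideal (x : Qp) : padic_max_ideal (schneider_map x).
Proof.
rewrite /schneider_map; case: eqVneq => [_|/schneider_digitP[] //].
by apply/padic_max_idealP; left.
Qed.

Definition schneider_finite : set Qp :=
  \bigcup_k [set x : Qp | padic_max_ideal x /\ iter k schneider_map x = 0].

(* a_i(x) and b_i(x), for i >= 1 *)
Definition schneider_a (i : nat) (x : Qp) : int :=
  schneider_exp (iter i.-1 schneider_map x).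
Definition schneider_b (i : nat) (x : Qp) : nat :=
  schneider_digit (iter i.-1 schneider_map x).

(* the continued fraction of depth n whose first partial quotient has index i *)
Fixpoint schneider_cf (x : Qp) (i n : nat) : Qp :=
  if n is m.+1 then
    p%:R ^ schneider_a i x / ((schneider_b i x)%:R + schneider_cf x i.+1 m)
  else 0.

(* p_n(x) / q_n(x) *)
Definition schneider_approx (n : nat) (x : Qp) : Qp := schneider_cf x 1 n.

End Padic.

Section HausdorffDimension.
Variables (R : realType) (T : Type) (d : T -> T -> R).
Local Open Scope ereal_scope.
Local Open Scope classical_set_scope.
Implicit Types A : set T.

Definition diam A : \bar R :=
  ereal_sup [set z | exists x y, [/\ A x, A y & z = (d x y)%:E]].

(* diam A to the power s, with the empty set contributing 0 even for s = 0 *)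
Definition diam_pow (s : R) A : \bar R :=
  if A == set0 then 0 else diam A `^ s.

Definition hausdorff_premeasure (s delta : R) A : \bar R :=
  ereal_inf [set \sum_(0 <= k <oo) diam_pow s (U k) | U in
    [set U : (set T)^nat |
      (forall k, diam (U k) <= delta%:E) /\ A `<=` \bigcup_k U k]].

Definition hausdorff_measure (s : R) A : \bar R :=
  ereal_sup [set hausdorff_premeasure s delta A | delta in [set r : R | (0 < r)%R]].

Definition hausdorff_dim A : \bar R :=
  ereal_inf [set s%:E | s in [set r : R | (0 <= r)%R /\ hausdorff_measure r A = 0]].

End HausdorffDimension.

Definition schneider_spectrum (R : realType) (p : nat) (alpha : R) : R :=
  let log_p x := ln x / ln p%:R in
  (ln (p%:R - 1) + ln (alpha - ln p%:R) - ln (ln p%:R)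
   + alpha * log_p alpha - alpha * log_p (alpha - ln p%:R)) / alpha.

(* Main.v *)
Require Import Defs.
From mathcomp Require Import all_boot all_order all_algebra.
From mathcomp Require Import all_classical all_reals all_analysis.
From mathcomp Require Import ring lra zify.
Import Order.TTheory GRing.Theory Num.Theory.
Import numFieldNormedType.Exports.
Local Open Scope classical_set_scope.
Local Open Scope ring_scope.
Set Implicit Arguments.
Unset Strict Implicit.
Unset Printing Implicit Defensive.

(** The map [T] is a full shift: writing [c = (a, b)] for a pair with [a >= 1] and
    [1 <= b < p], the branch [u |-> p ^ a / (b + u)] maps the maximal ideal onto the
    set of points with first letter [c], and [T] inverts it.  Because [b + u] is a
    unit, this branch multiplies all distances by [p ^ - a].  Hence the points with
    prescribed first [n] letters form a ball of diameter comparable with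
    [p ^ - (a_1 + ... + a_n)] ([same_letters_close], [close_same_letters]), and
    [x - p_n / q_n] has absolute value [p ^ - (a_1 + ... + a_(n+1))]
    ([padic_abs_approx]).  The set of the theorem is therefore the set of points
    whose exponents have average [b = alpha / ln p] ([level_setP]), and its
    dimension should be the largest entropy of a law on letters of mean exponent
    [b], divided by the Lyapunov exponent [alpha].  The maximum is attained by
    geometric exponents of mean [b] and uniform digits, and equals
    [ln (p - 1) + entropy b]; this is the expression of the theorem
    ([level_dimE]).

    Upper bound ([level_set_upper]).  For [s] above that quotient, the product law
    with geometric exponents gives to the cylinders of long prefixes of every point
    of the set a mass which exceeds the [s]-th power of their diameter by an
    exponential factor.  All words with this property, of length at least [N], give
    a cover whose weight is at most the tail of a geometric series
    ([hausdorff_measure_weights]).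

    Lower bound ([level_set_lower]).  For [s] below the quotient, fix a large [n] and
    consider the words of length [n] whose exponents add up to [floor (n * b)].
    They are counted by a binomial coefficient, and there are [G > p ^ (s * n * b)]
    of them ([many_compositions]).  Concatenations of such words, whose first
    exponents are corrected by at most one to make the average converge to [b],
    form a Cantor set inside the level set.  Every letter sequence being realised
    by a point ([letters_surj]), the base [G] expansion of a real number in [0, 1)
    selects a point of this Cantor set, and transports Lebesgue measure to a mass
    to which the mass distribution principle applies ([mass_distribution]).  The
    blocks of stage [j] have the same sum of exponents whatever the digits, so that
    cylinders of equal mass have equal diameter. *)

(** * The p-adic absolute value *)

Section PadicAbs.
Variables (R : realType) (p : nat) (p_pr : prime p).
Local Notation Zp := (padic_int p_pr).
Local Notation Qp := (padic p_pr).
Local Notation abs := (@padic_abs p p_pr R).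
Local Notation "x %:F" := (padic_of_int x).
Local Notation q := (p%:R^-1 : R).

Lemma p_gt0 : 0 < p%:R :> R. Proof. by rewrite ltr0n prime_gt0. Qed.
Lemma p_gt1 : 1 < p%:R :> R. Proof. by rewrite ltr1n prime_gt1. Qed.
Lemma pinv_gt0 : 0 < q. Proof. by rewrite invr_gt0 p_gt0. Qed.
Lemma pinv_ge0 : 0 <= q. Proof. exact/ltW/pinv_gt0. Qed.
Lemma pinv_lt1 : q < 1. Proof. by rewrite invf_lt1 ?p_gt0 ?p_gt1. Qed.
Lemma pinvX_gt0 n : 0 < q ^+ n. Proof. by rewrite exprn_gt0 ?pinv_gt0. Qed.
Lemma pinvX_le m n : (q ^+ m <= q ^+ n) = (n <= m)%N.
Proof. by rewrite ler_iXn2l ?pinv_gt0 ?pinv_lt1. Qed.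
Lemma pinvX_lt m n : (q ^+ m < q ^+ n) = (n < m)%N.
Proof. by rewrite ltr_iXn2l ?pinv_gt0 ?pinv_lt1. Qed.

Lemma padic_abs0 : abs 0 = 0. Proof. by rewrite /padic_abs eqxx. Qed.
Lemma padic_absE x : x != 0 -> abs x = p%:R ^ (- padic_val x).
Proof. by rewrite /padic_abs => /negbTE ->. Qed.
Lemma padic_abs_gt0 x : x != 0 -> 0 < abs x.
Proof. by move=> x0; rewrite padic_absE // exprz_gt0 ?p_gt0. Qed.
Lemma padic_abs_ge0 x : 0 <= abs x.
Proof. by have [->|/padic_abs_gt0/ltW//] := eqVneq x 0; rewrite padic_abs0. Qed.
Lemma padic_abs_eq0 x : (abs x == 0) = (x == 0).
Proof.
by have [->|/padic_abs_gt0/gt_eqF//] := eqVneq x 0; rewrite padic_abs0 eqxx.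
Qed.
Lemma padic_absM x y : abs (x * y) = abs x * abs y.
Proof.
have [->|x0] := eqVneq x 0; first by rewrite mul0r padic_abs0 mul0r.
have [->|y0] := eqVneq y 0; first by rewrite mulr0 padic_abs0 mulr0.
rewrite !padic_absE ?mulf_neq0 // padic_valM // opprD expfzDr //.
by rewrite gt_eqF ?p_gt0.
Qed.
Lemma padic_abs1 : abs 1 = 1.
Proof. by rewrite padic_absE ?oner_neq0 // padic_val1 oppr0 expr0z. Qed.
Lemma padic_absV x : abs x^-1 = (abs x)^-1.
Proof.
have [->|x0] := eqVneq x 0; first by rewrite invr0 padic_abs0 invr0.
apply: (@mulIf _ (abs x)); first by rewrite padic_abs_eq0.
by rewrite -padic_absM !mulVf ?padic_abs1 // padic_abs_eq0.
Qed.
Lemma padic_absX x n : abs (x ^+ n) = abs x ^+ n.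
Proof.
elim: n => [|n IH]; first by rewrite !expr0 padic_abs1.
by rewrite !exprS padic_absM IH.
Qed.
Lemma padic_abs_p : abs p%:R = q.
Proof. by rewrite padic_absE ?padic_p_neq0 // padic_val_p exprN1. Qed.

Lemma padic_abs_int_le (z : Zp) n : (abs z%:F <= q ^+ n) = (z n == 0).
Proof.
have [->|z0] := eqVneq z 0.
  by rewrite rmorph0 padic_abs0 residue0 eqxx exprn_ge0 ?pinv_ge0.
rewrite padic_absE ?padic_of_int_eq0 // padic_val_int // padic_int_valP //.
by rewrite -exprnN -exprVn pinvX_le.
Qed.

Lemma padic_absD x y : abs (x + y) <= Num.max (abs x) (abs y).
Proof.
have int_case (z w : Zp) : abs z%:F <= abs w%:F ->
    abs (z + w)%:F <= abs w%:F.
  have [->|w0] := eqVneq w 0; first by rewrite addr0.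
  have -> : abs w%:F = q ^+ padic_int_val w.
    by rewrite padic_absE ?padic_of_int_eq0 // padic_val_int // -exprnN exprVn.
  rewrite !padic_abs_int_le residue_add => /eqP ->.
  by rewrite add0r residue_mod padic_int_valP.
wlog xy : x y / abs x <= abs y.
  by move=> h; case/orP: (le_total (abs x) (abs y)) => /h //; rewrite addrC maxC.
rewrite max_r //.
have [y0|y0] := eqVneq y 0; first by move: xy; rewrite y0 addr0.
have [x0|x0] := eqVneq x 0; first by rewrite x0 add0r.
move: xy; have [a [b [a0 b0 ->]]] := padic_fracP x0.
have [c [d [c0 d0 ->]]] := padic_fracP y0.
have bd0 : (b * d)%:F != 0 :> Qp by rewrite padic_of_int_eq0 mulf_neq0.
have -> : a%:F / b%:F = (a * d)%:F / (b * d)%:F :> Qp.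
  by rewrite !rmorphM -mulf_div divff ?mulr1 // padic_of_int_eq0.
have -> : c%:F / d%:F = (c * b)%:F / (b * d)%:F :> Qp.
  by rewrite !rmorphM [b%:F * d%:F]mulrC -mulf_div divff ?mulr1 // padic_of_int_eq0.
rewrite -mulrDl -rmorphD !padic_absM padic_absV.
have i0 : 0 < (abs (b * d)%:F)^-1 by rewrite invr_gt0 padic_abs_gt0.
rewrite !ler_pM2r //; exact: int_case.
Qed.

Lemma padic_absN x : abs (- x) = abs x.
Proof.
rewrite -mulN1r padic_absM; suff -> : abs (-1) = 1 by rewrite mul1r.
have : abs (-1) ^+ 2 = 1 by rewrite -padic_absX sqrrN expr1n padic_abs1.
by move/eqP; rewrite sqrp_eq1 ?padic_abs_ge0 // => /eqP.
Qed.
Lemma padic_absB x y : abs (x - y) = abs (y - x).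
Proof. by rewrite -padic_absN opprB. Qed.

Lemma padic_absD_le x y c : abs x <= c -> abs y <= c -> abs (x + y) <= c.
Proof. by move=> xc yc; apply: le_trans (padic_absD _ _) _; rewrite ge_max xc. Qed.
Lemma padic_absD_lt x y c : abs x < c -> abs y < c -> abs (x + y) < c.
Proof. by move=> xc yc; apply: le_lt_trans (padic_absD _ _) _; rewrite gt_max xc. Qed.

(** Were the sum shorter than [x], then [x = (x + y) - y] would be shorter than
    itself. *)
Lemma padic_absD_eq x y : abs y < abs x -> abs (x + y) = abs x.
Proof.
move=> yx; apply/eqP; rewrite eq_le padic_absD_le ?(ltW yx) //=.
rewrite leNgt; apply/negP => h; have := padic_absD (x + y) (- y).
by rewrite addrK padic_absN leNgt gt_max h yx.
Qed.

Lemma padic_abs_small_eq0 x : (forall n, abs x <= q ^+ n) -> x = 0.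
Proof.
move=> xn; apply/eqP; rewrite -padic_abs_eq0 eq_le padic_abs_ge0 andbT.
have : q ^+ n @[n --> \oo] --> (0 : R).
  by apply: cvg_expr; rewrite ger0_norm ?pinv_ge0 ?pinv_lt1.
move=> /cvg_lim <- //; apply: limr_ge; last by apply: nearW.
by apply/cvg_ex; exists 0; apply: cvg_expr; rewrite ger0_norm ?pinv_ge0 ?pinv_lt1.
Qed.

Lemma max_ideal_abs_le (x : Qp) : padic_max_ideal x <-> abs x <= q.
Proof.
rewrite padic_max_idealP; have [->|x0] := eqVneq x 0.
  by rewrite padic_abs0 pinv_ge0; split=> // _; left.
rewrite padic_absE // -exprN1 ler_eXz2l ?p_gt1 //.
split=> [[/eqP|]|]; [by rewrite (negbTE x0)|lia|right; lia].
Qed.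
Lemma max_ideal_abs (x : Qp) : padic_max_ideal x <-> abs x < 1.
Proof.
split=> [/max_ideal_abs_le/le_lt_trans -> //|]; first exact: pinv_lt1.
rewrite padic_max_idealP; have [->|x0] := eqVneq x 0; first by left.
rewrite padic_absE // -(expr0z (p%:R : R)) ltr_eXz2l ?p_gt1 //; right; lia.
Qed.
Lemma max_ideal0 : padic_max_ideal (0 : Qp).
Proof. by apply/max_ideal_abs; rewrite padic_abs0. Qed.

Lemma padic_abs_nat_le1 n : abs n%:R <= 1.
Proof.
elim: n => [|n IH]; first by rewrite padic_abs0.
by rewrite -natr1 padic_absD_le ?padic_abs1.
Qed.

Lemma padic_abs_digit b : (0 < b < p)%N -> abs b%:R = 1.
Proof.
move=> bp; apply/eqP; rewrite eq_le padic_abs_nat_le1 /= leNgt.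
apply/negP => /max_ideal_abs/max_ideal_abs_le.
rewrite -(rmorph_nat (@padic_of_int p p_pr)) -(expr1 q) padic_abs_int_le padic_int_nat.
by rewrite expn1 modn_small; lia.
Qed.

Lemma padic_abs_digitD b u : (0 < b < p)%N -> padic_max_ideal u -> abs (b%:R + u) = 1.
Proof. by move=> bp /max_ideal_abs u1; rewrite padic_absD_eq padic_abs_digit. Qed.

Lemma padic_digitD_neq0 b u :
  (0 < b < p)%N -> padic_max_ideal u -> (b%:R + u : Qp) != 0.
Proof. by move=> bp u1; rewrite -padic_abs_eq0 padic_abs_digitD ?oner_neq0. Qed.

(** Subtracting the residue modulo [p] and dividing by [p], again and again, writes
    the p-adic integer [x] to any precision in base [p]. *)
Lemma padic_nat_dense n x : abs x <= 1 -> exists m : nat, abs (x - m%:R) <= q ^+ n.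
Proof.
elim: n x => [|n IH] x x1; first by exists 0%N; rewrite subr0 expr0.
have [b xb] : exists b : nat, abs (x - b%:R) <= q.
  have [/max_ideal_abs/max_ideal_abs_le xq|x1'] := ltP (abs x) 1.
    by exists 0%N; rewrite subr0.
  have xE : abs x = 1 by apply/eqP; rewrite eq_le x1 x1'.
  have x0 : x != 0 by rewrite -padic_abs_eq0 xE oner_neq0.
  have [||b [[_ bP] _]] := @padic_digit p p_pr x => //; last first.
    by exists b; apply/max_ideal_abs_le.
  move/eqP: xE; rewrite padic_absE // -(expr0z (p%:R : R)) eq_le.
  by rewrite !ler_eXz2l ?p_gt1 // => /andP[]; lia.
have p0 := padic_p_neq0 p_pr.
have [|m mP] := IH ((x - b%:R) / p%:R).
  by rewrite padic_absM padic_absV padic_abs_p invrK -ler_pdivlMr ?p_gt0 // mul1r.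
exists (b + p * m)%N; rewrite natrD natrM.
have -> : x - (b%:R + p%:R * m%:R) = p%:R * ((x - b%:R) / p%:R - m%:R).
  by rewrite mulrBr mulrCA divff // mulr1 opprD addrA.
by rewrite padic_absM padic_abs_p exprS ler_pM2l ?pinv_gt0.
Qed.

(** The residues modulo [p ^ n] of natural numbers [p ^ - n]-close to [u n] are
    coherent, hence are the residues of a p-adic integer, which is the limit. *)
Lemma padic_complete (u : nat -> Qp) : (forall n, abs (u n) <= 1) ->
  (forall n, abs (u n.+1 - u n) <= q ^+ n) ->
  exists x, forall n, abs (x - u n) <= q ^+ n.
Proof.
move=> u1 uS.
have /choice[m mP] n : exists m : nat, abs (u n - m%:R) <= q ^+ n.
  exact: padic_nat_dense.
have coh n : ((m n)%:Z %% (p ^ n)%N)%Z = ((m n.+1)%:Z %% (p ^ n)%N)%Z.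
  have : abs ((m n)%:R - (m n.+1)%:R) <= q ^+ n.
    have -> : (m n)%:R - (m n.+1)%:R
       = (((m n)%:R - u n) + (u n - u n.+1)) + (u n.+1 - (m n.+1)%:R) :> Qp.
      by rewrite !subrKA.
    apply: padic_absD_le; first apply: padic_absD_le.
    - by rewrite padic_absB mP.
    - by rewrite padic_absB uS.
    - by apply: le_trans (mP _) _; rewrite pinvX_le.
  rewrite -!(rmorph_nat (@padic_of_int p p_pr)) -rmorphB padic_abs_int_le.
  rewrite residue_add residueN !padic_int_nat modzDmr -!modz_nat => /eqP/dvdz_mod0P.
  by rewrite -eqz_mod_dvd !modz_mod => /eqP.
pose z : Zp := mk_padic_int p_pr coh.
exists z%:F => n; rewrite -(subrKA (m n)%:R).
apply: padic_absD_le; last by rewrite padic_absB mP.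
rewrite -(rmorph_nat (@padic_of_int p p_pr)) -rmorphB padic_abs_int_le residue_add residueN.
have -> : z n = (m n %% p ^ n)%N by rewrite /= modz_nat.
by rewrite padic_int_nat modzDmr subrr mod0z.
Qed.

End PadicAbs.

(** * Letters and branches of the Schneider map *)

Definition ok_letter (p : nat) (c : nat * nat) := (0 < c.1)%N && (0 < c.2 < p)%N.
Definition exp_sum (l : nat -> nat * nat) n : nat := (\sum_(i < n) (l i).1)%N.

Lemma exp_sumS l n : exp_sum l n.+1 = ((l 0).1 + exp_sum (fun i => l i.+1) n)%N.
Proof. exact: big_ord_recl. Qed.

Lemma exp_sum_mono l : {homo exp_sum l : m n / (m <= n)%N}.
Proof.
move=> m n /subnK <-; elim: (n - m)%N => [//|k IH].
by rewrite addSn (leq_trans IH) // /exp_sum big_ord_recr leq_addr.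
Qed.

Lemma eq_exp_sum l l' n : (forall i, (i < n)%N -> l i = l' i) ->
  exp_sum l n = exp_sum l' n.
Proof. by move=> ll'; apply: eq_bigr => i _; rewrite ll'. Qed.

Lemma leq_exp_sum p l n : (forall i, ok_letter p (l i)) -> (n <= exp_sum l n)%N.
Proof.
move=> lP; rewrite -[X in (X <= _)%N]mul1n -[in X in (X <= _)%N](card_ord n) mulnC.
rewrite -sum_nat_const; apply: leq_sum => i _; by case/andP: (lP i).
Qed.

Lemma branch_sub_id (F : fieldType) (P b u v : F) : b + u != 0 -> b + v != 0 ->
  P / (b + u) - P / (b + v) = P / (b + u) * (v - u) / (b + v).
Proof. by move=> u0 v0; field; rewrite u0 v0. Qed.

(** For [P = p ^ a] the brackets are the images of [x] and [y] under the Schneider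
    map, when these points have the same exponent [a] and digits [b] and [b']. *)
Lemma digit_sub_id (F : fieldType) (P b b' x y : F) : x != 0 -> y != 0 ->
  b - b' = (P * (y - x) / (x * y) - (P / x - b)) + (P / y - b').
Proof. by move=> x0 y0; field; rewrite x0 y0. Qed.

Lemma branch_tail_id (F : fieldType) (P b t : F) : P != 0 ->
  P / (P / (b + t)) - b = t.
Proof. by move=> P0; rewrite invf_div mulrCA divff // mulr1 addrC addKr. Qed.

Section Letters.
Variables (R : realType) (p : nat) (p_pr : prime p).
Local Notation Qp := (padic p_pr).
Local Notation abs := (@padic_abs p p_pr R).
Local Notation q := (p%:R^-1 : R).
Local Notation T := (@schneider_map p p_pr).
Local Notation ok_letter := (ok_letter p).

(** The inverse branch of the Schneider map indexed by the letter [c]. *)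
Definition branch (c : nat * nat) (u : Qp) : Qp := p%:R ^+ c.1 / (c.2%:R + u).

(** The valuation is positive on the nonzero points of the maximal ideal; the
    absolute value serves to get a natural number. *)
Definition letter (x : Qp) : nat * nat := (`|padic_val x|%N, schneider_digit x).
Definition letters (x : Qp) i := letter (iter i T x).

Definition nonterminating (x : Qp) :=
  (@padic_max_ideal p p_pr `\` @schneider_finite p p_pr) x.

Lemma padic_abs_branch c u : ok_letter c -> padic_max_ideal u ->
  abs (branch c u) = q ^+ c.1.
Proof.
move=> /andP[_ c2] u1; rewrite padic_absM padic_absV padic_abs_digitD // invr1.
by rewrite mulr1 padic_absX padic_abs_p.
Qed.

Lemma branch_max_ideal c u : ok_letter c -> padic_max_ideal u ->
  padic_max_ideal (branch c u).
Proof.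
move=> cP u1; apply/(max_ideal_abs R); rewrite padic_abs_branch //.
by rewrite -(expr0 q) pinvX_lt //; case/andP: cP.
Qed.

Lemma branch_neq0 c u : ok_letter c -> padic_max_ideal u -> branch c u != 0.
Proof.
move=> cP u1; rewrite -(padic_abs_eq0 R) padic_abs_branch // gt_eqF //.
exact: pinvX_gt0.
Qed.

(** A branch is a similarity, because the denominators are units. *)
Lemma padic_abs_branchB c u v : ok_letter c ->
  padic_max_ideal u -> padic_max_ideal v ->
  abs (branch c u - branch c v) = q ^+ c.1 * abs (u - v).
Proof.
move=> cP u1 v1; have c2 : (0 < c.2 < p)%N by case/andP: cP.
have u0 := padic_digitD_neq0 R c2 u1; have v0 := padic_digitD_neq0 R c2 v1.
rewrite [X in abs X](branch_sub_id _ u0 v0) -/(branch c u).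
rewrite 2!padic_absM padic_absV padic_abs_branch // padic_abs_digitD //.
by rewrite invr1 mulr1 padic_absB.
Qed.

Lemma padic_abs_val_nat (x : Qp) n : x != 0 -> abs x = q ^+ n -> padic_val x = n.
Proof.
move=> x0; rewrite padic_absE // exprVn exprnN => /eqP.
by rewrite eq_le !ler_eXz2l ?p_gt1 // => /andP[]; lia.
Qed.

Lemma digit_uniq b b' : (0 < b < p)%N -> (0 < b' < p)%N ->
  padic_max_ideal (b%:R - b'%:R : Qp) -> b = b'.
Proof.
wlog bb' : b b' / (b' <= b)%N.
  move=> h bP b'P bb'; case/orP: (leq_total b' b) => [/h|le]; first exact.
  apply/esym/h => //; apply/(max_ideal_abs R).
  by rewrite padic_absB; apply/(max_ideal_abs R).
move=> bP b'P /(max_ideal_abs R); rewrite -natrB //.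
case: (posnP (b - b')) => [|d0]; first lia.
by rewrite padic_abs_digit ?ltxx //; lia.
Qed.

Lemma letter_branch c u : ok_letter c -> padic_max_ideal u ->
  letter (branch c u) = c /\ T (branch c u) = u.
Proof.
move=> cP u1; have c2 : (0 < c.2 < p)%N by case/andP: cP.
have x0 := branch_neq0 cP u1.
have vE : padic_val (branch c u) = c.1.
  by apply: padic_abs_val_nat => //; rewrite padic_abs_branch.
have [dP] := schneider_digitP x0.
have pc0 : p%:R ^+ c.1 != 0 :> Qp by rewrite expf_neq0 ?padic_p_neq0.
have -> : p%:R ^ schneider_exp (branch c u) / branch c u = c.2%:R + u.
  by rewrite /schneider_exp vE /branch invf_div mulrCA divff // mulr1.
move=> dig; have dE : schneider_digit (branch c u) = c.2.
  apply/esym/digit_uniq => //; apply/(max_ideal_abs R).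
  have -> : c.2%:R - (schneider_digit (branch c u))%:R
    = (c.2%:R + u - (schneider_digit (branch c u))%:R) - u by rewrite addrAC addrK.
  by apply: padic_absD_lt; rewrite ?padic_absN; apply/max_ideal_abs.
split; first by rewrite /letter vE dE absz_nat; case: (c).
rewrite /schneider_map (negbTE x0) dE /schneider_exp vE /branch.
by rewrite invf_div mulrCA divff // mulr1 addrC addKr.
Qed.

Lemma branch_letter (x : Qp) : x != 0 -> padic_max_ideal x ->
  ok_letter (letter x) /\ x = branch (letter x) (T x).
Proof.
move=> x0 x1; have [dP dig] := schneider_digitP x0.
have vx : (0 < padic_val x)%R.
  by move/padic_max_idealP: x1 => -[/eqP|//]; rewrite (negbTE x0).
rewrite /ok_letter /letter /= dP andbT; split; first lia.
rewrite /branch /schneider_map (negbTE x0) /= addrC subrK invf_div mulrCA.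
rewrite /schneider_exp -[X in _ ^ X]gez0_abs ?ltW //.
by rewrite -exprnP divff ?mulr1 // expf_neq0 ?padic_p_neq0.
Qed.

Lemma nonterminating_neq0 x : nonterminating x -> x != 0.
Proof. by move=> [x1]; apply: contra_notN => /eqP x0; exists 0%N. Qed.

Lemma nonterminating_map x : nonterminating x -> nonterminating (T x).
Proof.
move=> [x1 xF]; split; first exact: schneider_map_max_ideal.
by apply: contra_not xF => -[k _ [_ Tk]]; exists k.+1 => //; split=> //; rewrite iterSr.
Qed.


Lemma nonterminating_branch x : nonterminating x ->
  ok_letter (letter x) /\ x = branch (letter x) (T x).
Proof. by move=> ix; apply: branch_letter (nonterminating_neq0 ix) _; case: ix. Qed.

Lemma lettersS x i : letters x i.+1 = letters (T x) i.
Proof. by rewrite /letters iterSr. Qed.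

Lemma exp_sum_letters x n :
  exp_sum (letters x) n.+1 = ((letter x).1 + exp_sum (letters (T x)) n)%N.
Proof.
by rewrite exp_sumS; congr (_ + _)%N; apply: eq_exp_sum => i _; rewrite lettersS.
Qed.

Lemma ok_letters x i : nonterminating x -> ok_letter (letters x i).
Proof.
elim: i x => [|i IH] x ix; first by case: (nonterminating_branch ix).
by rewrite lettersS; apply/IH/nonterminating_map.
Qed.

Lemma schneider_cfS x i n :
  schneider_cf x i.+2 n = schneider_cf (T x) i.+1 n.
Proof.
elim: n i => [//|n IH] i /=; rewrite IH.
by rewrite /schneider_a /schneider_b [i.+2.-1]/= [i.+1.-1]/= iterSr.
Qed.

Lemma schneider_approxS n x : nonterminating x ->
  schneider_approx n.+1 x = branch (letter x) (schneider_approx n (T x)).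
Proof.
move=> ix; rewrite /schneider_approx /= schneider_cfS /branch /letter /=.
rewrite /schneider_a /schneider_b /= /schneider_exp.
have vx : (0 < padic_val x)%R.
  have := nonterminating_neq0 ix; case: ix => /padic_max_idealP[->|//].
  by rewrite eqxx.
by rewrite -[in LHS](gez0_abs (ltW vx)).
Qed.

Lemma schneider_approx_max_ideal n x :
  nonterminating x -> padic_max_ideal (schneider_approx n x).
Proof.
elim: n x => [|n IH] x ix; first exact: max_ideal0 R _ _.
rewrite schneider_approxS //; apply: branch_max_ideal.
  by case: (nonterminating_branch ix).
exact/IH/nonterminating_map.
Qed.

(** The approximation is the image of [0], and the point [x] that of its [n]-th
    iterate, under the same composite of [n] branches. *)
Lemma padic_abs_approx n x : nonterminating x ->
  abs (x - schneider_approx n x) = q ^+ exp_sum (letters x) n.+1.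
Proof.
elim: n x => [|n IH] x ix; have [cP xE] := nonterminating_branch ix.
  rewrite subr0 /exp_sum big_ord1 xE padic_abs_branch ?(letter_branch _ _).1 //.
  + by rewrite -xE.
  + exact: schneider_map_max_ideal.
have iT := nonterminating_map ix.
rewrite schneider_approxS // {1}xE padic_abs_branchB // ?IH //.
- by rewrite -exprD -exp_sum_letters.
- exact: schneider_map_max_ideal.
- exact: schneider_approx_max_ideal.
Qed.

(** Points with the same first letters are images of two points under the same
    composite of branches, which contracts distances by the product of the
    ratios [q ^+ a_i]. *)
Lemma same_letters_close n x y : nonterminating x -> nonterminating y ->
  (forall i, (i < n)%N -> letters x i = letters y i) ->
  abs (x - y) <= q ^+ exp_sum (letters x) n.
Proof.
elim: n x y => [|n IH] x y ix iy xy.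
  rewrite /exp_sum big_ord0 expr0.
  apply: padic_absD_le; rewrite ?padic_absN ltW //; apply/max_ideal_abs.
    by case: ix.
  by case: iy.
have [cx xE] := nonterminating_branch ix; have [cy yE] := nonterminating_branch iy.
have lxy : letter x = letter y by have := xy 0%N isT.
rewrite {1}xE {1}yE -lxy padic_abs_branchB //; try exact: schneider_map_max_ideal.
rewrite exp_sum_letters exprD ler_pM2l ?pinvX_gt0 //.
by apply: IH; [exact: nonterminating_map..|move=> i ni; rewrite -!lettersS xy].
Qed.

(** A point at distance less than [abs x] from [x] has the same exponent as [x];
    the digits then agree because they are the residues of [p ^ a / x] and
    [p ^ a / y].  So the two points come from the same branch, which can be
    inverted. *)
Lemma close_same_letters n x y : nonterminating x -> nonterminating y ->
  abs (x - y) < q ^+ exp_sum (letters x) n ->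
  forall i, (i < n)%N -> letters x i = letters y i.
Proof.
elim: n x y => [//|n IH] x y ix iy xy.
have [cx xE] := nonterminating_branch ix; have [cy yE] := nonterminating_branch iy.
have Tx := schneider_map_max_ideal x; have Ty := schneider_map_max_ideal y.
have ax : abs x = q ^+ (letter x).1 by rewrite {1}xE padic_abs_branch.
have ay : abs y = q ^+ (letter y).1 by rewrite {1}yE padic_abs_branch.
rewrite exp_sum_letters exprD in xy.
have xyx : abs (x - y) < abs x.
  rewrite ax; apply: lt_le_trans xy _; rewrite -exprD pinvX_le //.
  exact: leq_addr.
have exy : (letter y).1 = (letter x).1.
  have : abs y = abs x.
    by rewrite -[y](subKr x) padic_absD_eq // padic_absN.
  rewrite ax ay => /eqP; rewrite eq_le !pinvX_le //; lia.
have lxy : letter x = letter y.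
  rewrite [LHS]surjective_pairing [RHS]surjective_pairing exy; congr (_, _).
  have [/andP[_ dx] /andP[_ dy]] := (cx, cy).
  apply: digit_uniq => //; apply/(max_ideal_abs R).
  have x0 := nonterminating_neq0 ix; have y0 := nonterminating_neq0 iy.
  (* the digits are p^a / x - T x and p^a / y - T y, with the same p^a *)
  have px0 n' : p%:R ^+ n' != 0 :> Qp by rewrite expf_neq0 ?padic_p_neq0.
  have tx : p%:R ^+ (letter x).1 / x - (letter x).2%:R = T x.
    by rewrite {2}xE branch_tail_id.
  have ty : p%:R ^+ (letter x).1 / y - (letter y).2%:R = T y.
    by rewrite -exy {2}yE branch_tail_id.
  rewrite (digit_sub_id (p%:R ^+ (letter x).1) _ _ x0 y0) tx ty.
  apply: padic_absD_lt; last exact/max_ideal_abs.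
  apply: padic_absD_lt; last by rewrite padic_absN; apply/max_ideal_abs.
  rewrite 2!padic_absM padic_absV padic_absM padic_absX padic_abs_p ax ay exy.
  rewrite -mulf_div divff ?gt_eqF ?pinvX_gt0 // mul1r.
  by rewrite ltr_pdivrMr ?pinvX_gt0 // mul1r padic_absB -ax.
case=> [_ //|i ni]; rewrite !lettersS; apply: IH => //; try exact: nonterminating_map.
by rewrite {1}xE {1}yE -lxy padic_abs_branchB // ltr_pM2l ?pinvX_gt0 in xy.
Qed.

Fixpoint branches (l : nat -> nat * nat) n : Qp :=
  if n is m.+1 then branch (l 0) (branches (fun i => l i.+1) m) else 0.

Lemma branches_max_ideal l n :
  (forall i, ok_letter (l i)) -> padic_max_ideal (branches l n).
Proof.
elim: n l => [|n IH] l lP; first exact: max_ideal0 R _ _.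
by apply: branch_max_ideal => //; apply: IH.
Qed.

Lemma branches_cauchy l n : (forall i, ok_letter (l i)) ->
  abs (branches l n.+1 - branches l n) <= q ^+ n.
Proof.
elim: n l => [|n IH] l lP.
  rewrite subr0 expr0 ltW //; apply/max_ideal_abs; exact: branches_max_ideal.
rewrite [branches l n.+2]/= [branches l n.+1]/= padic_abs_branchB //.
- rewrite exprS ler_pM ?exprn_ge0 ?pinv_ge0 ?padic_abs_ge0 //; last exact: IH.
  by rewrite -[leRHS]expr1 pinvX_le //; case/andP: (lP 0%N).
- exact: (@branches_max_ideal (fun i => l i.+1) n.+1).
- exact: branches_max_ideal.
Qed.

(** The finite continued fractions of a letter sequence form a Cauchy sequence
    since branches contract.  Its limit is the image, under the branch of the first
    letter, of the limit for the shifted sequence; so the Schneider map acts as the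
    shift on these limits, and none of them is [0]. *)
Lemma letters_surj l : (forall i, ok_letter (l i)) ->
  exists2 x, nonterminating x & forall i, letters x i = l i.
Proof.
have lim l' : (forall i, ok_letter (l' i)) ->
    exists x, forall n, abs (x - branches l' n) <= q ^+ n.
  move=> lP; apply: padic_complete => n; last exact: branches_cauchy.
  apply/ltW/max_ideal_abs; exact: branches_max_ideal.
have lim_ideal l' x : (forall i, ok_letter (l' i)) ->
    (forall n, abs (x - branches l' n) <= q ^+ n) -> padic_max_ideal x.
  move=> lP xP; apply/(max_ideal_abs R); rewrite -[x](subrK (branches l' 1)).
  apply: padic_absD_lt; last exact/max_ideal_abs/branches_max_ideal.
  by apply: le_lt_trans (xP 1%N) _; rewrite expr1 pinv_lt1.
have limS l' x y : (forall i, ok_letter (l' i)) ->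
    (forall n, abs (x - branches l' n) <= q ^+ n) ->
    (forall n, abs (y - branches (fun i => l' i.+1) n) <= q ^+ n) ->
    x = branch (l' 0) y.
  move=> lP xP yP; have sP i : ok_letter (l' i.+1) by [].
  apply/eqP; rewrite -subr_eq0; apply/eqP/(@padic_abs_small_eq0 R) => n.
  rewrite -[x - _](subrKA (branches l' n.+1)); apply: padic_absD_le.
    by apply: le_trans (xP _) _; rewrite pinvX_le.
  rewrite padic_absB [branches l' n.+1]/= padic_abs_branchB //.
  - apply: le_trans (yP n); rewrite ler_piMl ?padic_abs_ge0 //.
    by rewrite exprn_ile1 ?pinv_ge0 ?ltW ?pinv_lt1.
  - exact: (lim_ideal (fun i => l' i.+1)).
  - exact: branches_max_ideal.
move=> lP; pose tl k := fun i => l (k + i)%N.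
have tlP k i : ok_letter (tl k i) by exact: lP.
have /choice[x xP] k := lim (tl k) (tlP k).
have xI k : padic_max_ideal (x k) by apply: (lim_ideal (tl k)).
have xS k : x k = branch (l k) (x k.+1).
  rewrite (limS (tl k) (x k) (x k.+1)) // /tl ?addn0 // => n.
  have -> : (fun i => l (k + i.+1)%N) = tl k.+1.
    by apply/funext => i; rewrite /tl addnS.
  exact: xP.
have xT k : iter k T (x 0%N) = x k.
  elim: k => [//|k IH]; rewrite iterS IH {1}xS.
  by case: (letter_branch (lP k) (xI k.+1)).
exists (x 0%N); last first.
  by move=> i; rewrite /letters xT xS; case: (letter_branch (lP i) (xI i.+1)).
split; first exact: xI.
move=> [k _ [_]]; rewrite xT xS; apply/eqP; exact: branch_neq0.
Qed.

End Letters.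

(** * Covers and Hausdorff measure *)

Section HausdorffUpper.
Variables (R : realType) (T : Type) (d : T -> T -> R).
Local Open Scope ereal_scope.

Lemma diam_le (A : set T) (c : R) : (forall x y, A x -> A y -> (d x y <= c)%R) ->
  diam d A <= c%:E.
Proof.
move=> Ac; apply: ge_ereal_sup => _ [x [y [Ax Ay ->]]].
by rewrite lee_fin Ac.
Qed.

Lemma diam_ge (A : set T) x y : A x -> A y -> (d x y)%:E <= diam d A.
Proof. by move=> Ax Ay; apply: ereal_sup_ubound; exists x, y. Qed.

Lemma diam_pow_ge0 s (A : set T) : 0 <= diam_pow d s A.
Proof. by rewrite /diam_pow; case: ifP => // _; exact: poweR_ge0. Qed.

Lemma diam_pow0 s : diam_pow d s set0 = 0.
Proof. by rewrite /diam_pow eqxx. Qed.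

Lemma diam_pow_le s (A : set T) (c : R) : (0 <= s)%R -> (0 <= c)%R ->
  (forall x y, (0 <= d x y)%R) ->
  (forall x y, A x -> A y -> (d x y <= c)%R) ->
  diam_pow d s A <= (c `^ s)%:E.
Proof.
move=> s0 c0 d0 Ac; rewrite /diam_pow; case: eqVneq => [_|/set0P[x Ax]].
  by rewrite lee_fin powR_ge0.
have A0 : 0 <= diam d A by apply: le_trans (diam_ge Ax Ax); rewrite lee_fin.
rewrite -poweR_EFin; apply: gt0_ler_poweR => //; last exact: diam_le.
  by rewrite in_itv /= A0 leey.
by rewrite in_itv /= lee_fin c0 leey.
Qed.

Lemma hausdorff_measure_eq0 s (A : set T) :
  (forall delta e : R, (0 < delta)%R -> (0 < e)%R ->
    exists U : (set T)^nat, [/\ forall k, diam d (U k) <= delta%:E,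
      A `<=` \bigcup_k U k & \sum_(0 <= k <oo) diam_pow d s (U k) <= e%:E]) ->
  hausdorff_measure d s A = 0.
Proof.
move=> h; apply/eqP; rewrite eq_le; apply/andP; split.
  apply: ge_ereal_sup => _ [delta /= delta0 <-].
  apply/lee_addgt0Pr => e e0; rewrite add0e.
  have [U [dU AU Ue]] := h delta e delta0 e0.
  by apply: le_trans Ue; apply: ereal_inf_lbound; exists U.
apply: le_trans (ereal_sup_ubound _); last by exists 1%R => //=; exact: ltr01.
by apply: le_ereal_inf_tmp => _ [U _ <-]; apply: nneseries_ge0 => k _ _; exact: diam_pow_ge0.
Qed.

End HausdorffUpper.

(** * Multiplicative weights on words *)

Section Words.
Variable R : realType.

Lemma ler_sum_uniq (I : eqType) (s t : seq I) (f : I -> R) : uniq s ->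
  {subset s <= t} -> (forall i, 0 <= f i) ->
  \sum_(i <- s) f i <= \sum_(i <- t) f i.
Proof.
move=> + + f0; elim: s t => [|x s IH] t /=.
  by move=> _ _; rewrite big_nil sumr_ge0.
move=> /andP[xs us] st; have xt : x \in t by rewrite st ?mem_head.
rewrite big_cons (big_rem x xt) /= lerD2l; apply: IH => // y ys.
have yx : y != x by apply: contraNneq xs => <-.
have : y \in t by rewrite st // inE ys orbT.
by rewrite (perm_mem (perm_to_rem xt)) inE (negbTE yx).
Qed.

Fixpoint words (T : Type) (A : seq T) n : seq (seq T) :=
  if n is m.+1 then [seq a :: w | a <- A, w <- words A m] else [:: [::]].

Lemma mem_words (T : eqType) (A : seq T) w : {subset w <= A} ->
  w \in words A (size w).
Proof.
elim: w => [|a w IH] wA; first by rewrite mem_head.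
by apply: allpairs_f; [rewrite wA ?mem_head|apply: IH => b bw; rewrite wA // inE bw orbT].
Qed.

Lemma sum_words (T : Type) (A : seq T) (g : T -> R) n :
  \sum_(w <- words A n) \prod_(c <- w) g c = (\sum_(c <- A) g c) ^+ n.
Proof.
elim: n => [|n IH]; first by rewrite big_seq1 big_nil expr0.
rewrite [words A n.+1]/= big_allpairs_dep exprS mulr_suml; apply: eq_bigr => a _.
by rewrite -IH mulr_sumr; apply: eq_bigr => w _; rewrite big_cons.
Qed.

Lemma sum_all_words (T : Type) (A : seq T) (g : T -> R) rho N M :
  (forall c, 0 <= g c) -> \sum_(c <- A) g c <= rho -> 0 < rho -> rho < 1 ->
  \sum_(w <- flatten [seq words A n | n <- iota N M]) \prod_(c <- w) g c
    <= rho ^+ N / (1 - rho).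
Proof.
move=> g0 gr r0 r1; rewrite big_flatten big_map.
apply: (@le_trans _ _ (\sum_(n <- iota N M) rho ^+ n)).
  apply: ler_sum => n _; rewrite sum_words lerXn2r ?nnegrE ?sumr_ge0 //.
  exact: ltW.
elim: M N => [|M IH] N /=.
  by rewrite big_nil divr_ge0 ?exprn_ge0 ?ltW // subr_gt0.
rewrite big_cons; apply: le_trans (lerD (lexx _) (IH N.+1)) _.
rewrite exprS ler_pdivlMr ?subr_gt0 // mulrDl mulfVK ?subr_eq0 ?gt_eqF //.
by rewrite mulrBr mulr1 mulrC subrK.
Qed.

End Words.

Section LetterWeights.
Variables (R : realType) (p : nat).
Hypothesis p1 : (1 < p)%N.

(** [rho] times the law of independent exponent and digit, geometric of mean
    [(1 - r)^-1] and uniform respectively. *)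
Definition letter_weight (rho r : R) (c : nat * nat) : R :=
  rho * ((1 - r) * r ^+ c.1.-1 / (p%:R - 1)).

Lemma sum_letter_weight rho r (M : nat) : 0 <= rho -> 0 < r < 1 ->
  \sum_(c <- [seq (a.+1, b.+1) | a <- iota 0 M, b <- iota 0 p.-1])
    letter_weight rho r c <= rho.
Proof.
move=> rho0 /andP[r0 r1]; rewrite big_allpairs_dep.
have pE : (p.-1)%:R = p%:R - 1 :> R by rewrite -subn1 natrB // ltnW.
have -> : \sum_(a <- iota 0 M) \sum_(b <- iota 0 p.-1) letter_weight rho r (a.+1, b.+1)
   = rho * (\sum_(a <- iota 0 M) (1 - r) * r ^+ a).
  rewrite mulr_sumr; apply: eq_bigr => a _; rewrite /letter_weight /=.
  rewrite big_const_seq count_predT size_iota iter_addr addr0 -[_ *+ p.-1]mulr_natr pE.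
  by rewrite -!mulrA mulVf ?mulr1 // -pE pnatr_eq0; lia.
rewrite ler_piMr // -mulr_sumr.
have -> : \sum_(a <- iota 0 M) r ^+ a = \sum_(i < M) r ^+ i.
  by rewrite -[M in iota 0 M]subn0 -/(index_iota 0 M) big_mkord.
rewrite -opprB mulNr -subrX1 opprB lerBlDl lerDr exprn_ge0 // ltW //.
Qed.

End LetterWeights.

(** * Upper bound *)

Lemma leq_sum_mem (I : eqType) (s : seq I) (f : I -> nat) x : x \in s ->
  (f x <= \sum_(i <- s) f i)%N.
Proof. by move=> xs; rewrite (big_rem x) //= leq_addr. Qed.

Section UpperBound.
Variables (R : realType) (p : nat) (p_pr : prime p).
Local Notation Qp := (padic p_pr).
Local Notation abs := (@padic_abs p p_pr R).
Local Notation q := (p%:R^-1 : R).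

Definition cylinder (w : seq (nat * nat)) : set Qp :=
  [set x | nonterminating x /\
    forall i, (i < size w)%N -> letters x i = nth (0, 0)%N w i].

Definition word_sum (w : seq (nat * nat)) : nat := (\sum_(c <- w) c.1)%N.

Lemma word_sum_mkseq l n : word_sum (mkseq l n) = exp_sum l n.
Proof.
by rewrite /word_sum big_map -[n in iota 0 n]subn0 -/(index_iota 0 n) big_mkord.
Qed.

Lemma cylinder_sum w x : cylinder w x -> exp_sum (letters x) (size w) = word_sum w.
Proof.
move=> [ix wx]; rewrite -word_sum_mkseq; congr word_sum.
apply: (@eq_from_nth _ (0, 0)%N); rewrite size_mkseq // => i iw.
by rewrite nth_mkseq // wx.
Qed.

Lemma cylinder_dist w x y : cylinder w x -> cylinder w y ->
  abs (x - y) <= q ^+ word_sum w.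
Proof.
move=> wx wy; rewrite -(cylinder_sum wx); apply: same_letters_close.
- by case: wx.
- by case: wy.
- by move=> i iw; case: wx => _ ->//; case: wy => _ ->.
Qed.

Lemma cylinder_size_dist w x y : cylinder w x -> cylinder w y ->
  abs (x - y) <= q ^+ size w.
Proof.
move=> wx wy; apply: le_trans (cylinder_dist wx wy) _; rewrite pinvX_le //.
rewrite -(cylinder_sum wx); apply: (@leq_exp_sum p) => i.
by apply: ok_letters; case: wx.
Qed.

Lemma letter_weight_ge0 rho r c : 0 <= rho -> 0 < r < 1 ->
  0 <= letter_weight p rho r c :> R.
Proof.
move=> rho0 /andP[r0 r1]; rewrite /letter_weight !mulr_ge0 ?exprn_ge0 //.
- by rewrite subr_ge0 ltW.
- exact: ltW.
- by rewrite invr_ge0 subr_ge0 ltW // p_gt1.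
Qed.

(** The product of the letter weights is a multiplicative mass on words, of total
    [rho ^+ n] on the words of length [n].  If it dominates the [s]-th power of the
    diameter for arbitrarily long prefixes of every point of [E], the cylinders of
    these prefixes cover [E] with total weight the tail of a geometric series. *)
Lemma hausdorff_measure_weights (s rho r : R) (E : set Qp) :
  0 <= s -> 0 < rho < 1 -> 0 < r < 1 -> (forall x, E x -> nonterminating x) ->
  (forall x N, E x -> exists2 n, (N <= n)%N &
     (q ^+ exp_sum (letters x) n) `^ s
       <= \prod_(c <- mkseq (letters x) n) letter_weight p rho r c) ->
  hausdorff_measure (@padic_dist p p_pr R) s E = 0%E.
Proof.
move=> s0 /andP[rho0 rho1] r01 Eirr Ew.
have p1 := prime_gt1 p_pr.
apply: hausdorff_measure_eq0 => delta e delta0 e0.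
have [N [Nd Ne]] : exists N, q ^+ N <= delta /\ rho ^+ N / (1 - rho) <= e.
  have qd : \forall n \near \oo, q ^+ n <= delta.
    have : q ^+ n @[n --> \oo] --> (0 : R).
      by apply: cvg_expr; rewrite ger0_norm ?pinv_ge0 ?pinv_lt1.
    move=> /cvgr_le; exact.
  have qe : \forall n \near \oo, rho ^+ n <= e * (1 - rho).
    have : rho ^+ n @[n --> \oo] --> (0 : R).
      by apply: cvg_expr; rewrite ger0_norm // ltW.
    by move=> /cvgr_le; apply; rewrite mulr_gt0 // subr_gt0.
  near \oo => N; exists N; split; first by near: N.
  by rewrite ler_pdivrMr ?subr_gt0 //; near: N.
pose mass w : R := \prod_(c <- w) letter_weight p rho r c.
have mass0 w : 0 <= mass w.
  by apply: prodr_ge0 => c _; apply: letter_weight_ge0 => //; exact: ltW.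
pose good w := [&& all (ok_letter p) w, (N <= size w)%N &
  (q ^+ word_sum w) `^ s <= mass w].
pose word (k : nat) : option (seq (nat * nat)) := pickle_inv k.
pose U k := if word k is Some w then
  if good w then cylinder w else set0 else set0.
exists U; split.
- move=> k; apply: diam_le => x y; rewrite /U; case: (word _) => // w.
  case: ifP => // /and3P[_ Nw _] wx wy.
  apply: le_trans (cylinder_size_dist wx wy) _; apply: le_trans Nd.
  by rewrite pinvX_le.
- move=> x Ex; have [n Nn ngood] := Ew x N Ex.
  exists (pickle (mkseq (letters x) n)) => //=; rewrite /U /word pickleK_inv.
  have -> : good (mkseq (letters x) n).
    rewrite /good size_mkseq Nn word_sum_mkseq ngood !andbT.
    apply/allP => c /mapP[i _ ->]; exact/ok_letters/Eirr.
  split; first exact: Eirr.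
  by move=> i; rewrite size_mkseq => ni; rewrite nth_mkseq.
pose F k : R := if word k is Some w then
  if good w then mass w else 0 else 0.
have UF k : (diam_pow (@padic_dist p p_pr R) s (U k) <= (F k)%:E)%E.
  rewrite /U /F; case: (word _) => [w|]; last by rewrite diam_pow0.
  case: ifP => [/and3P[_ _ wm]|_]; last by rewrite diam_pow0.
  apply: le_trans (diam_pow_le s0 _ _ (@cylinder_dist w)) _.
  + exact/ltW/pinvX_gt0.
  + by move=> *; exact: padic_abs_ge0.
  + by rewrite lee_fin.
apply: lime_le; first by apply: is_cvg_nneseries => k _ _; exact: diam_pow_ge0.
apply: nearW => K.
apply: (@le_trans _ _ (\sum_(0 <= k < K) F k)%:E).
  by rewrite -sumEFin; apply: lee_sum => k _; exact: UF.
rewrite lee_fin; apply: le_trans Ne.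
pose L := pmap word (iota 0 K).
have Lu : uniq [seq w <- L | good w].
  rewrite filter_uniq //; apply: (pmap_uniq (@pickle_invK _)); exact: iota_uniq.
have -> : \sum_(0 <= k < K) F k = \sum_(w <- [seq w <- L | good w]) mass w.
  rewrite big_filter [RHS]big_mkcond /L big_pmap /index_iota subn0.
  by apply: eq_bigr => k _; rewrite /F; case: (word _).
pose M := (\sum_(w <- L) word_sum w)%N.
pose B := (\sum_(w <- L) (size w).+1)%N.
apply: le_trans (sum_all_words N B _ (sum_letter_weight p1 M (ltW rho0) r01) _ _) => //.
  apply: ler_sum_uniq => // w; rewrite mem_filter => /andP[/and3P[/allP wok Nw _] wL].
  apply/flattenP; exists (words [seq (a.+1, b.+1) | a <- iota 0 M, b <- iota 0 p.-1] (size w)).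
    apply/mapP; exists (size w) => //; rewrite mem_iota Nw /=.
    have wB : (size w < B)%N by apply: (@leq_sum_mem _ L (fun w => (size w).+1)).
    exact: leq_trans wB (leq_addl _ _).
  apply: mem_words => -[a b] abw; have /andP[/= a0 /andP[b0 bp]] := wok _ abw.
  apply/allpairsP; exists (a.-1, b.-1); rewrite !mem_iota /= !prednK // !add0n.
  have aw : (a <= word_sum w)%N by apply: (@leq_sum_mem _ w (fun c => c.1) _ abw).
  have wM : (word_sum w <= M)%N by apply: leq_sum_mem.
  by split=> //; [exact: leq_trans wM|rewrite -ltnS prednK // prime_gt0].
by move=> c; apply: letter_weight_ge0 => //; exact: ltW.
Unshelve. all: by end_near. Qed.

End UpperBound.

Section LevelSet.
Variables (R : realType) (p : nat) (p_pr : prime p).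
Local Notation Qp := (padic p_pr).
Local Notation abs := (@padic_abs p p_pr R).
Local Notation q := (p%:R^-1 : R).
Local Notation L := (ln (p%:R : R)).

Definition level_set (alpha : R) : set Qp :=
  [set x | nonterminating x /\
    (fun n : nat => n%:R^-1 * ln (abs (x - schneider_approx n x))) @ \oo
      --> - alpha].

Lemma ln_p_gt0 : 0 < L. Proof. by rewrite ln_gt0 // p_gt1. Qed.

Lemma ln_pinvX n : ln (q ^+ n) = - (n%:R * L).
Proof. by rewrite lnXn ?pinv_gt0 // lnV ?posrE ?p_gt0 // mulNrn mulr_natl. Qed.

(** By [padic_abs_approx] the logarithm of the error is [- L] times a sum of
    exponents. *)
Lemma level_setP alpha x : nonterminating x ->
  level_set alpha x <->
  (exp_sum (letters x) n.+1)%:R / n%:R @[n --> \oo] --> alpha / L.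
Proof.
move=> nx; have L0 : L != 0 by rewrite gt_eqF ?ln_p_gt0.
have aE n : n%:R^-1 * ln (abs (x - schneider_approx n x))
   = - (exp_sum (letters x) n.+1)%:R / n%:R * L.
  by rewrite padic_abs_approx // ln_pinvX mulrN mulNr mulrC mulrAC mulNr.
have -> : level_set alpha x <->
    - (exp_sum (letters x) n.+1)%:R / n%:R * L @[n --> \oo] --> - alpha.
  rewrite /level_set /= (_ : (fun n => _) = fun n =>
    - (exp_sum (letters x) n.+1)%:R / n%:R * L); last exact/funext.
  by split=> [[]|].
split=> h.
  have -> : alpha / L = - ((- alpha) / L) by rewrite mulNr opprK.
  rewrite (_ : (fun n => _) =
    fun n => - (- (exp_sum (letters x) n.+1)%:R / n%:R * L / L)).
    by apply: cvgN; apply: cvgMl.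
  by apply/funext => n; rewrite mulfK // mulNr opprK.
have -> : - alpha = - (alpha / L) * L by rewrite mulNr divfK.
apply: cvgMl; rewrite (_ : (fun n => _) =
  fun n => - ((exp_sum (letters x) n.+1)%:R / n%:R)); first exact: cvgN.
by apply/funext => n; rewrite mulNr.
Qed.

Lemma ln_word_weight (rho r : R) l n : 0 < rho -> 0 < r < 1 ->
  (forall i, ok_letter p (l i)) ->
  0 < \prod_(c <- mkseq l n) letter_weight p rho r c /\
  ln (\prod_(c <- mkseq l n) letter_weight p rho r c) =
    n%:R * (ln rho + ln (1 - r) - ln (p%:R - 1) - ln r)
    + (exp_sum l n)%:R * ln r.
Proof.
move=> rho0 /andP[r0 r1] lP.
have p1 : 0 < p%:R - 1 :> R by rewrite subr_gt0 p_gt1.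
have r1' : 0 < 1 - r by rewrite subr_gt0.
elim: n => [|n [w0 IH]].
  by rewrite big_nil ln1 mul0r add0r /exp_sum big_ord0 mul0r; split.
have -> : mkseq l n.+1 = rcons (mkseq l n) (l n).
  by rewrite /mkseq -addn1 iotaD map_cat cats1.
rewrite big_rcons /=; set w := \prod_(c <- _) _ in w0 IH *.
have g0 : 0 < letter_weight p rho r (l n).
  by rewrite /letter_weight !mulr_gt0 ?invr_gt0 ?exprn_gt0.
split; first by rewrite mulr_gt0.
rewrite lnM ?posrE // IH /letter_weight.
rewrite lnM ?posrE ?mulr_gt0 ?invr_gt0 ?exprn_gt0 //.
rewrite ln_div ?posrE ?mulr_gt0 ?exprn_gt0 // lnM ?posrE ?exprn_gt0 // lnXn //.
rewrite {2}/exp_sum big_ord_recr /= -/(exp_sum l n) natrD -natr1.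
have -> : (l n).1%:R = (l n).1.-1%:R + 1 :> R.
  by rewrite natr1 prednK //; case/andP: (lP n).
by rewrite -mulr_natl; ring.
Qed.

(** On the level set the mean logarithm of [letter_weight 1 r] along the letters
    tends to [- (ln (p - 1) - ln (1 - r) - (alpha / L - 1) * ln r)], that of the
    diameters to [- alpha].  The gap [eta] between the two sides of the hypothesis
    leaves room for a factor [rho < 1] per letter. *)
Lemma level_set_null (alpha s r : R) : 0 <= s -> 0 < r < 1 ->
  ln (p%:R - 1) - ln (1 - r) - (alpha / L - 1) * ln r < s * alpha ->
  hausdorff_measure (@padic_dist p p_pr R) s (level_set alpha) = 0%E.
Proof.
move=> s0 r01 h; set beta := alpha / L in h.
have L0 := ln_p_gt0.
have aE : alpha = beta * L by rewrite /beta divfK // gt_eqF.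
pose eta := s * alpha - (ln (p%:R - 1) - ln (1 - r) - (beta - 1) * ln r).
have eta0 : 0 < eta by rewrite subr_gt0.
pose rho : R := expR (- (eta / 2)).
have rho0 : 0 < rho by exact: expR_gt0.
have rho1 : rho < 1 by rewrite -expR0 ltr_expR oppr_lt0 divr_gt0.
apply: (@hausdorff_measure_weights _ _ _ s rho r) => //.
- by rewrite rho0.
- by move=> x [].
move=> x N ax; have nx : nonterminating x by case: ax.
pose A := ln rho + ln (1 - r) - ln (p%:R - 1) - ln r.
pose B := ln r + s * L.
have AB : 0 < A + beta * B.
  rewrite /A /B /rho expRK; have := eta0; rewrite /eta aE; lra.
have cv : (1 + n%:R^-1) * A + (exp_sum (letters x) n.+1)%:R / n%:R * B
    @[n --> \oo] --> (1 + 0) * A + beta * B.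
  apply: cvgD; apply: cvgMl; last exact/level_setP.
  by apply: cvgD; [exact: cvg_cst|rewrite -cvg_shiftS; exact: cvg_harmonic].
rewrite addr0 mul1r in cv.
near \oo => n.
have n0 : (0 < n)%N by near: n; exact: nbhs_infty_gt.
exists n.+1; first by apply: leqW; near: n; exact: nbhs_infty_ge.
have [w0 wE] := ln_word_weight n.+1 rho0 r01 (fun i => ok_letters i nx).
rewrite -ler_ln ?posrE ?powR_gt0 ?pinvX_gt0 //.
rewrite ln_powR wE ln_pinvX -/A mulrN lerNl -subr_ge0.
have : 0 <= (1 + n%:R^-1) * A + (exp_sum (letters x) n.+1)%:R / n%:R * B.
  by apply: ltW; near: n; apply: (cvgr_gt _ cv).
have n0' : 0 < n%:R :> R by rewrite ltr0n.
move=> /(mulr_ge0 (ltW n0')).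
have -> : n%:R * ((1 + n%:R^-1) * A + (exp_sum (letters x) n.+1)%:R / n%:R * B)
   = n.+1%:R * A + (exp_sum (letters x) n.+1)%:R * B.
  by rewrite -natr1; field; rewrite gt_eqF.
by rewrite /B; lra.
Unshelve. all: by end_near. Qed.

(** The Shannon entropy of the geometric law of mean [b] on the positive integers;
    it vanishes at [b = 1] because [ln 0 = 0]. *)
Definition entropy (b : R) := b * ln b - (b - 1) * ln (b - 1).

Definition level_dim (alpha : R) : R :=
  if alpha == L then ln (p%:R - 1) / L else schneider_spectrum p alpha.

(** Both branches say that the dimension is the entropy of the letters divided by
    their Lyapunov exponent [alpha]. *)
Lemma level_dimE alpha : L <= alpha ->
  level_dim alpha * alpha = ln (p%:R - 1) + entropy (alpha / L).
Proof.
have L0 := ln_p_gt0.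
rewrite /level_dim le_eqVlt eq_sym => /orP[/eqP ->|La].
  by rewrite eqxx divfK ?gt_eqF // divff ?gt_eqF // /entropy subrr ln1; lra.
have a0 : 0 < alpha by apply: lt_trans La.
have b1 : 0 < alpha / L - 1 by rewrite subr_gt0 ltr_pdivlMr ?mul1r.
rewrite gt_eqF // /schneider_spectrum divfK ?gt_eqF // /entropy.
have -> : alpha - L = (alpha / L - 1) * L by rewrite mulrBl divfK ?gt_eqF // mul1r.
rewrite lnM ?posrE // ln_div ?posrE //.
by field; rewrite gt_eqF.
Qed.

Lemma entropy_ge0 b : 1 <= b -> 0 <= entropy b.
Proof.
rewrite /entropy le_eqVlt => /orP[/eqP <-|b1].
  by rewrite ln1 subrr; lra.
have : ln (b - 1) <= ln b by rewrite ler_ln ?posrE; lra.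
have : 0 <= ln b by rewrite ln_ge0 // ltW.
by nra.
Qed.

Lemma ln_pred_p_ge0 : 0 <= ln (p%:R - 1 : R).
Proof. by rewrite ln_ge0 // lerBrDr -[1 + 1]/(2%:R) ler_nat prime_gt1. Qed.

Lemma level_dim_ge0 alpha : L <= alpha -> 0 <= level_dim alpha.
Proof.
move=> La; have L0 := ln_p_gt0; have a0 : 0 < alpha by apply: lt_le_trans La.
rewrite -(pmulr_lge0 _ a0) level_dimE // addr_ge0 ?ln_pred_p_ge0 ?entropy_ge0 //.
by rewrite ler_pdivlMr ?mul1r.
Qed.

(** The optimal geometric law has the mean [alpha / L] of the exponents on the level
    set. *)
Lemma level_set_upper alpha s : L <= alpha -> level_dim alpha < s ->
  hausdorff_measure (@padic_dist p p_pr R) s (level_set alpha) = 0%E.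
Proof.
move=> La Ds; have L0 := ln_p_gt0; have a0 : 0 < alpha by apply: lt_le_trans La.
have s0 : 0 <= s by rewrite ltW // (le_lt_trans (level_dim_ge0 La)).
have hs : ln (p%:R - 1) + entropy (alpha / L) < s * alpha.
  by rewrite -level_dimE // ltr_pM2r.
have b1 : 1 <= alpha / L by rewrite ler_pdivlMr ?mul1r.
move: b1 hs; set b := alpha / L; rewrite le_eqVlt => /orP[/eqP b1|b1] hs.
  (* the extremal geometric law is degenerate: use laws close to it *)
  pose eta := s * alpha - ln (p%:R - 1).
  have eta0 : 0 < eta.
    by rewrite subr_gt0; move: hs; rewrite -b1 /entropy ln1 subrr; lra.
  apply: (@level_set_null _ _ (1 - expR (- (eta / 2)))) => //.
    by rewrite subr_gt0 ltrBlDr ltrDl expR_gt0 andbT -expR0 ltr_expR oppr_lt0 divr_gt0.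
  by rewrite -/b -b1 subKr expRK subrr mul0r subr0; move: eta0; rewrite /eta; lra.
have b0 : 0 < b by apply: lt_trans b1.
have bE : 1 - (b - 1) / b = b^-1 by rewrite mulrBl divff ?gt_eqF // subKr mul1r.
apply: (@level_set_null _ _ ((b - 1) / b)) => //.
  rewrite divr_gt0 ?subr_gt0 //= ltr_pdivrMr //; lra.
rewrite -/b bE lnV ?posrE // [X in _ * X]ln_div ?posrE ?subr_gt0 //.
by move: hs; rewrite /entropy; lra.
Qed.

End LevelSet.

(** * Counting words of given length and sum *)

Section Compositions.
Variable p : nat.
Hypothesis p_gt1 : (1 < p)%N.

Definition add_head (d : nat) (w : seq (nat * nat)) :=
  if w is c :: t then ((d + c.1)%N, c.2) :: t else [::].

(** Sorting the words of length [n] and sum [m] according to whether their first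
    exponent is [1] gives Pascal's recursion for their number. *)
Fixpoint compositions (n m : nat) {struct m} : seq (seq (nat * nat)) :=
  match m with
  | 0 => if n is 0 then [:: [::]] else [::]
  | m'.+1 => if n is n'.+1 then
      [seq (1%N, b.+1) :: w | b <- iota 0 p.-1, w <- compositions n' m']
      ++ [seq add_head 1 w | w <- compositions n m']
    else [::]
  end.

Lemma size_add_head d w : size (add_head d w) = size w.
Proof. by case: w. Qed.

Lemma add_head_inj d : injective (add_head d).
Proof.
by move=> [|[a b] w] [|[a' b'] w'] //= [/addnI -> -> ->].
Qed.

Lemma word_sum_add_head d w : (0 < size w)%N ->
  word_sum (add_head d w) = (d + word_sum w)%N.
Proof. by case: w => // c w _; rewrite /word_sum !big_cons addnA. Qed.

Lemma ok_add_head d w : all (ok_letter p) w -> all (ok_letter p) (add_head d w).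
Proof.
by case: w => //= c w /andP[/andP[c1 c2] ->]; rewrite /ok_letter c2 !andbT addn_gt0 c1 orbT.
Qed.

Lemma mem_compositions n m w : w \in compositions n m ->
  [/\ size w = n, word_sum w = m & all (ok_letter p) w].
Proof.
elim: m n w => [|m IH] [|n] w //=.
  by rewrite inE => /eqP ->; split=> //; rewrite /word_sum big_nil.
rewrite mem_cat => /orP[/allpairsP[[b u] /= [bp uc ->]]|/mapP[u uc ->]].
  have [su wu ou] := IH _ _ uc; rewrite /= su /word_sum big_cons -/(word_sum u) wu add1n.
  by split=> //; rewrite ou andbT /ok_letter /=; move: bp; rewrite mem_iota; lia.
have [su wu ou] := IH _ _ uc.
by rewrite size_add_head word_sum_add_head ?su // wu ok_add_head.
Qed.

Lemma compositions_uniq n m : uniq (compositions n m).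
Proof.
elim: m n => [|m IH] [|n] //=; rewrite cat_uniq; apply/and3P; split.
- by apply: allpairs_uniq => //; [exact: iota_uniq|move=> [? ?] [? ?] _ _ [-> ->]].
- apply/hasPn => _ /mapP[u uc ->]; apply/negP => /allpairsP[[b v] /= [_ _]].
  have [_ _] := mem_compositions uc.
  by case: u {uc} => //= c u /andP[/andP[c1 _] _] []; lia.
- by rewrite map_inj_uniq //; exact: add_head_inj.
Qed.

Lemma size_compositions n m :
  size (compositions n.+1 m.+1) = (p.-1 ^ n.+1 * 'C(m, n))%N.
Proof.
elim: m n => [|m IH] n.
  rewrite [compositions _ _]/= cats0 size_allpairs size_iota.
  by case: n => [|n] /=; rewrite ?bin0 ?muln1 ?expn1 // bin0n !muln0.
rewrite [compositions _ _]/= -/(compositions n m.+1) size_cat size_allpairs.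
rewrite size_iota size_map.
have -> : size ([seq (1%N, b.+1) :: w | b <- iota 0 p.-1, w <- compositions n m] ++
    [seq add_head 1 w | w <- compositions n.+1 m]) = (p.-1 ^ n.+1 * 'C(m, n))%N.
  exact: IH.
case: n => [|n]; first by rewrite /= muln0 add0n !bin0.
by rewrite IH mulnA -expnS binS mulnDr addnC.
Qed.

End Compositions.

(** The index [k] is a mode of the binomial law of parameters [N] and [k / N], as
    the quotients of consecutive terms show; so its probability is at least the
    mean [1 / (N + 1)] of the [N + 1] probabilities. *)
Lemma binomial_mode N k : (k <= N)%N ->
  (N ^ N <= N.+1 * ('C(N, k) * k ^ k * (N - k) ^ (N - k)))%N.
Proof.
move=> kN; pose t i := ('C(N, i) * ((N - k) ^ (N - i) * k ^ i))%N.
have tS i : (i < N)%N -> (t i.+1 * (i.+1 * (N - k)) = t i * ((N - i) * k))%N.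
  move=> iN; rewrite /t -(subnSK iN) (expnS _ (N - i.+1)) (expnS k i).
  have e := mul_bin_left N i; rewrite -(subnSK iN) in e.
  transitivity ((i.+1 * 'C(N, i.+1)) * (N - k) ^ (N - i.+1).+1 * k ^ i * k)%N.
    by rewrite expnS; ring.
  by rewrite e expnS; ring.
have up i : (i < k)%N -> (t i <= t i.+1)%N.
  move=> ik; have iN : (i < N)%N by apply: leq_trans kN.
  have h : (0 < (N - i) * k)%N by rewrite muln_gt0; lia.
  rewrite -(leq_pmul2r h) -tS // leq_mul2l; apply/orP; right.
  by rewrite mulnC leq_mul //; lia.
have down i : (k <= i)%N -> (t i.+1 <= t i)%N.
  move=> ki; case: (ltnP i N) => iN; last by rewrite /t bin_small.
  have h : (0 < i.+1 * (N - k))%N by rewrite muln_gt0; lia.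
  rewrite -(leq_pmul2r h) tS // leq_mul2l; apply/orP; right.
  by rewrite mulnC leq_mul //; lia.
have tk i : (t i <= t k)%N.
  case: (leqP i k) => [ik|/ltnW/subnKC <-].
    rewrite -(subKn ik); elim: (k - i)%N => [|e IH]; first by rewrite subn0.
    apply: leq_trans IH; case: (ltnP e k) => ek; last first.
      by rewrite (eqP (_ : k - e.+1 == 0)%N) ?subn_eq0 ?leqW // (eqP (_ : k - e == 0)%N) ?subn_eq0.
    by rewrite -(subnSK ek); apply: up; lia.
  elim: (i - k)%N => [|e IH]; first by rewrite addn0.
  by apply: leq_trans IH; rewrite addnS; apply: down; lia.
have {1}-> : (N ^ N = ((N - k) + k) ^ N)%N by rewrite subnK.
rewrite expnDn; apply: (@leq_trans (\sum_(i < N.+1) t k)).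
  by apply: leq_sum => i _; exact: tk.
rewrite sum_nat_const card_ord leq_mul2l /t; apply/orP; right; lia.
Qed.

Section CountCompositions.
Variable R : realType.

Lemma ln_natXn (k : nat) : ln ((k ^ k)%N%:R : R) = k%:R * ln (k%:R : R).
Proof.
case: k => [|k]; first by rewrite expn0 ln1 mul0r.
by rewrite natrX lnXn ?ltr0n // mulr_natl.
Qed.

Lemma ln_binomial_ge (N k : nat) : (k <= N)%N ->
  N%:R * ln (N%:R : R) - k%:R * ln (k%:R : R) - (N - k)%:R * ln ((N - k)%:R : R)
    - ln (N.+1%:R : R) <= ln ('C(N, k)%:R : R).
Proof.
move=> kN.
have xx0 j : 0 < (j ^ j)%N%:R :> R.
  by rewrite ltr0n expn_gt0; case: j.
have c0 : 0 < 'C(N, k)%:R :> R by rewrite ltr0n bin_gt0.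
have : ln ((N ^ N)%N%:R : R) <=
    ln ((N.+1 * ('C(N, k) * k ^ k * (N - k) ^ (N - k)))%N%:R : R).
  rewrite ler_ln ?posrE ?ler_nat ?binomial_mode //.
  by rewrite !natrM !mulr_gt0 // ltr0n.
have N0 : 0 < N.+1%:R :> R by rewrite ltr0n.
rewrite !natrM lnM ?posrE ?mulr_gt0 // lnM ?posrE ?mulr_gt0 //.
rewrite lnM ?posrE // !ln_natXn; lra.
Qed.

(** Up to the factor [(p - 1) ^ n.+1] the size is ['C(m, n)], which is at least
    ['C(m.+1, n.+1) / m.+1]; the latter binomial coefficient is compared with the
    entropy by [binomial_mode]. *)
Lemma ln_size_compositions (p n m : nat) : (1 < p)%N -> (n <= m)%N ->
  n.+1%:R * (ln (p%:R - 1) + entropy (m.+1%:R / n.+1%:R)) - 2 * ln (m.+2%:R : R)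
    <= ln ((size (compositions p n.+1 m.+1))%:R : R).
Proof.
move=> p1 nm; have p10 : 0 < p%:R - 1 :> R by rewrite subr_gt0 ltr1n.
have c0 : 0 < 'C(m, n)%:R :> R by rewrite ltr0n bin_gt0.
rewrite size_compositions natrM natrX -subn1 natrB ?(ltnW p1) //.
rewrite lnM ?posrE ?exprn_gt0 // lnXn // -[ln _ *+ _]mulr_natl.
have cmn : ln ('C(m.+1, n.+1)%:R : R) - ln (m.+1%:R : R) <= ln ('C(m, n)%:R : R).
  rewrite lerBlDl -lnM ?posrE ?ltr0n ?bin_gt0 // -natrM.
  rewrite ler_ln ?posrE ?ltr0n ?muln_gt0 ?bin_gt0 //.
  by rewrite mul_bin_diag ler_nat mulSn leq_addr.
have ln12 : ln (m.+1%:R : R) <= ln (m.+2%:R : R) by rewrite ler_ln ?posrE ?ltr0n // ler_nat.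
have := @ln_binomial_ge m.+1 n.+1 nm.
suff -> : m.+1%:R * ln m.+1%:R - n.+1%:R * ln n.+1%:R
     - (m.+1 - n.+1)%:R * ln ((m.+1 - n.+1)%:R : R)
   = n.+1%:R * entropy (m.+1%:R / n.+1%:R) :> R by lra.
set a : R := m.+1%:R; set b : R := n.+1%:R.
have a0 : 0 < a by rewrite ltr0n.
have b0 : 0 < b by rewrite ltr0n.
rewrite natrB // -/a -/b /entropy.
have -> : a / b - 1 = (a - b) / b by rewrite mulrBl divff ?gt_eqF.
rewrite [ln (a / b)]ln_div ?posrE //.
have : b <= a by rewrite ler_nat.
rewrite le_eqVlt => /orP[/eqP ->|ba].
  by rewrite !subrr !mul0r; field; rewrite gt_eqF.
by rewrite ln_div ?posrE ?subr_gt0 //; field; rewrite gt_eqF.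
Qed.

(** For [m = floor (n * b)] the quotient [m / n] tends to [b], and the polynomial
    factors lost in [ln_size_compositions] are negligible against [n] times the gap
    between [t] and the limit. *)
Lemma many_compositions (p : nat) (b t : R) : (1 < p)%N -> 1 <= b ->
  t < ln (p%:R - 1) + entropy b ->
  exists2 n, (0 < n)%N &
    n%:R * t < ln ((size (compositions p n (Num.truncn (n%:R * b))))%:R : R).
Proof.
move=> p1 b1 tb.
pose eta := (ln (p%:R - 1) + entropy b - t) / 2.
have eta0 : 0 < eta by rewrite divr_gt0 // subr_gt0.
pose m n := Num.truncn (n%:R * b).
have b0 : 0 < b by apply: lt_le_trans b1.
have mP n : (m n)%:R <= n%:R * b < (m n)%:R + 1.
  by rewrite natr1 /m truncn_itv // mulr_ge0 // ltW.
have cV : (n%:R^-1 : R) @[n --> \oo] --> 0.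
  by rewrite -cvg_shiftS; exact: cvg_harmonic.
have cm : (m n)%:R / n%:R @[n --> \oo] --> b.
  apply: (@squeeze_cvgr _ _ _ _ (fun n => b - n%:R^-1) (fun=> b)).
  - near=> n; have n0 : 0 < n%:R :> R by rewrite ltr0n; near: n; exact: nbhs_infty_gt.
    have /andP[lo hi] := mP n.
    rewrite ler_pdivrMr // ler_pdivlMr // mulrBl mulVf ?gt_eqF // mulrC lo andbT.
    by rewrite lerBlDr ltW.
  - by rewrite -[X in _ --> X]subr0; apply: cvgB => //; exact: cvg_cst.
  - exact: cvg_cst.
have ce : \forall n \near \oo, entropy b - eta < entropy ((m n)%:R / n%:R).
  move: b1; rewrite le_eqVlt => /orP[/eqP eb|b1].
    near=> n; have n0 : 0 < n%:R :> R by rewrite ltr0n; near: n; exact: nbhs_infty_gt.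
    by rewrite /m -eb mulr1 natrK divff ?gt_eqF // ltrBlDr ltrDl.
  suff : entropy ((m n)%:R / n%:R) @[n --> \oo] --> entropy b.
    by move=> /cvgr_gt; apply; rewrite ltrBlDr ltrDl.
  have cm1 : (m n)%:R / n%:R - 1 @[n --> \oo] --> b - 1.
    by apply: cvgB => //; exact: cvg_cst.
  apply: cvgB; apply: cvgM => //.
    by apply: (@cvg_comp _ _ _ _ (@ln R) _ _ _ cm); exact: continuous_ln.
  by apply: (@cvg_comp _ _ _ _ (@ln R) _ _ _ cm1); apply: continuous_ln; rewrite subr_gt0.
(* [ln y <= delta * y - ln delta] makes the logarithmic error negligible *)
pose delta := eta / (4 * b).
have delta0 : 0 < delta by rewrite divr_gt0 // mulr_gt0.
have cb : \forall n \near \oo, 2 * (delta - ln delta) / (eta / 2) < n%:R.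
  exact: nbhs_infty_gtr.
near \oo => n.
have n0 : (0 < n)%N by near: n; exact: nbhs_infty_gt.
have n0' : 0 < n%:R :> R by rewrite ltr0n.
exists n => //; rewrite -/(m n).
have [lo hi] := andP (mP n).
have nm : (n <= m n)%N by rewrite /m truncn_ge_nat ?mulr_ge0 ?(ltW b0) // ler_peMr.
have m0 : (0 < m n)%N by apply: leq_trans nm.
have := @ln_size_compositions p n.-1 (m n).-1 p1; rewrite !prednK // => /(_ _).
have -> : (n.-1 <= (m n).-1)%N by rewrite -ltnS !prednK.
move=> /(_ isT); apply: lt_le_trans.
have e1 : entropy b - eta < entropy ((m n)%:R / n%:R) by near: n.
have lnm : ln ((m n).+1%:R : R) <= delta * (n%:R * b + 1) - ln delta.
  rewrite lerBrDr -lnM ?posrE ?ltr0n //.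
  apply: le_trans (ltW (ln_sublinear _)) _; first by rewrite mulr_gt0 ?ltr0n.
  by rewrite mulrC ler_pM2l // -natr1 lerD2r.
have big : 2 * (delta - ln delta) < n%:R * (eta / 2).
  rewrite -ltr_pdivrMr; last exact: divr_gt0.
  by near: n; exact: cb.
have e2 : delta * (n%:R * b) = n%:R * (eta / 4).
  by rewrite /delta; field; rewrite gt_eqF.
have e3 : n%:R * (entropy b - eta) < n%:R * entropy ((m n)%:R / n%:R).
  by rewrite ltr_pM2l.
have e4 : n%:R * t = n%:R * (ln (p%:R - 1) + entropy b) - n%:R * (2 * eta).
  by rewrite /eta; field.
rewrite [delta * _]mulrDr mulr1 e2 in lnm.
rewrite e4; move: e3 lnm big; lra.
Unshelve. all: by end_near. Qed.

End CountCompositions.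

(** * Mass distribution *)

Section Digits.
Variables (R : realType) (G : nat).
Hypothesis G_gt1 : (1 < G)%N.

(** The [j]-th digit after the point of [y] in base [G], for [y] in [0, 1). *)
Definition digit (y : R) (j : nat) : nat := (Num.truncn (G%:R ^+ j.+1 * y) %% G)%N.

Lemma base_gt0 : 0 < G%:R :> R. Proof. by rewrite ltr0n ltnW. Qed.

Lemma digit_lt y j : (digit y j < G)%N.
Proof. by rewrite ltn_mod ltnW. Qed.

Lemma truncn_natl_div (x : R) : 0 <= x -> (Num.truncn (G%:R * x) %/ G)%N = Num.truncn x.
Proof.
move=> x0; have g0 : (0 < G)%N by exact: ltnW.
have gx0 : 0 <= G%:R * x by rewrite mulr_ge0.
have [lo hi] := andP (truncn_itv x0); have [lo' hi'] := andP (truncn_itv gx0).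
apply/eqP; rewrite eqn_leq leq_divRL // -ltnS ltn_divLR //.
rewrite truncn_ge_nat // natrM [X in X <= _]mulrC ler_pM2l ?base_gt0 // lo andbT.
rewrite truncn_lt_nat // natrM mulrC ltr_pM2r ?base_gt0 //.
Qed.

Lemma digits_truncn y y' j : 0 <= y < 1 -> 0 <= y' < 1 ->
  (forall i, (i < j)%N -> digit y i = digit y' i) ->
  Num.truncn (G%:R ^+ j * y) = Num.truncn (G%:R ^+ j * y').
Proof.
have t0 z : 0 <= z < 1 -> Num.truncn (1 * z) = 0%N.
  by move=> /andP[z0 z1]; apply/eqP; rewrite mul1r truncn_eq // z0 z1.
move=> /[dup] yi /andP[y0 _] /[dup] yi' /andP[y0' _].
elim: j => [|j IH] yy; first by rewrite expr0 !t0.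
rewrite (divn_eq (Num.truncn _) G) [RHS](divn_eq (Num.truncn _) G).
rewrite -/(digit y j) -/(digit y' j) yy //; congr (_ * _ + _)%N.
have gz z : 0 <= z -> 0 <= G%:R ^+ j * z by move=> z0; rewrite mulr_ge0 ?exprn_ge0.
rewrite exprS -!mulrA !truncn_natl_div; [|exact: gz..].
by apply: IH => i ij; rewrite yy // ltnW.
Qed.

Lemma digits_close y y' j : 0 <= y < 1 -> 0 <= y' < 1 ->
  (forall i, (i < j)%N -> digit y i = digit y' i) ->
  `|y - y'| <= G%:R^-1 ^+ j.
Proof.
move=> yi yi' /(digits_truncn yi yi') e.
have gj : 0 < G%:R ^+ j :> R by rewrite exprn_gt0 // base_gt0.
have : `|G%:R ^+ j * y - G%:R ^+ j * y'| <= 1.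
  have [lo hi] := andP (truncn_itv (mulr_ge0 (ltW gj) (andP yi).1)).
  have [lo' hi'] := andP (truncn_itv (mulr_ge0 (ltW gj) (andP yi').1)).
  rewrite ler_distl; move: lo hi lo' hi'; rewrite e -natr1; lra.
by rewrite -mulrBr normrM gtr0_norm // -ler_pdivlMl // mulr1 exprVn.
Qed.

End Digits.

(** Mass distribution: [f] transports Lebesgue measure of [0, 1) to [E], and the
    transported mass of a set of diameter [D] is at most [2 * G * D `^ s]. *)
Lemma mass_distribution (R : realType) (T : Type) (d : T -> T -> R) (E : set T)
    (f : R -> T) (s : R) (G : nat) (h : nat -> R) : (1 < G)%N -> 0 <= s ->
  (forall x y, 0 <= d x y) -> (forall y, 0 <= y < 1 -> E (f y)) ->
  (forall j y y', 0 <= y < 1 -> 0 <= y' < 1 ->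
     d (f y) (f y') < h j -> `|y - y'| <= G%:R^-1 ^+ j) ->
  h 0%N = 1 -> (forall j, 0 < h j) -> h j @[j --> \oo] --> 0 ->
  (forall j, G%:R^-1 ^+ j.+1 <= h j.+1 `^ s) ->
  hausdorff_measure d s E <> 0%E.
Proof.
move=> G1 s0 d0 fE fd h0 hpos hcv hs.
have G0 : 0 < G%:R :> R by rewrite ltr0n ltnW.
pose c : R := (2 * G%:R)^-1.
have c0 : 0 < c by rewrite invr_gt0 mulr_gt0.
suff : (c%:E <= hausdorff_measure d s E)%E.
  by move=> + e; rewrite e lee_fin leNgt c0.
apply: (@le_trans _ _ (hausdorff_premeasure d s 2^-1 E)); last first.
  by apply: ereal_sup_ubound; exists 2^-1 => //=; rewrite invr_gt0.
apply: le_ereal_inf_tmp => _ [U [Ud EU] <-].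
have /choice[I IP] k : exists I : set R, [/\ measurable I,
    (c%:E * lebesgue_measure I <= diam_pow d s (U k))%E &
    forall y, 0 <= y < 1 -> U k (f y) -> I y].
  have [[y0 [y0i Uy0]]|none] :=
      pselect (exists y0, 0 <= y0 < 1 /\ U k (f y0)); last first.
    exists set0; split => //; first by rewrite measure0 mule0 diam_pow_ge0.
    by move=> y yi Uy; apply: none; exists y.
  have Dle := Ud k; have Dge := diam_ge d Uy0 Uy0.
  have [D DE] : exists D : R, diam d (U k) = D%:E.
    by case: (diam d (U k)) Dle Dge => [D _ _|//|//]; exists D.
  rewrite DE !lee_fin in Dle Dge; have D0 : 0 <= D by apply: le_trans Dge.
  have UD y y' : U k (f y) -> U k (f y') -> d (f y) (f y') <= D.
    by move=> Uy Uy'; have := diam_ge d Uy Uy'; rewrite DE lee_fin.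
  have powE : diam_pow d s (U k) = (D `^ s)%:E.
    rewrite /diam_pow DE poweR_EFin; case: eqVneq => // U0.
    by move: Uy0; rewrite U0.
  have [Dz|Dpos] : D = 0 \/ 0 < D.
    by move: D0; rewrite le_eqVlt => /orP[/eqP|]; [left|right].
    exists [set y0]; split; first exact: measurable_set1.
      by rewrite lebesgue_measure_set1 mule0 diam_pow_ge0.
    move=> y yi Uy; apply/eqP; rewrite -subr_eq0 -normr_le0.
    have gcv : G%:R^-1 ^+ j @[j --> \oo] --> (0 : R).
      apply: cvg_expr; rewrite ger0_norm ?invr_ge0 ?ltW // invf_lt1 //.
      by rewrite ltr1n.
    rewrite -(cvg_lim _ gcv) //; apply: limr_ge; first by apply/cvg_ex; exists 0.
    apply: nearW => j; apply: fd => //; apply: le_lt_trans (hpos j).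
    by rewrite -Dz UD.
  (* at the first scale not exceeding [D], the preceding one still exceeds it *)
  have exj : exists j, h j <= D.
    have /cvgr_le/(_ _ Dpos) := hcv => hD.
    by near \oo => j; exists j; near: j.
  case: (ex_minnP exj) => -[|j] hj jmin.
    by move: hj; rewrite h0 => /le_trans/(_ Dle); lra.
  have Dj : D < h j by rewrite ltNge; apply/negP => /jmin; rewrite ltnn.
  exists `[y0 - G%:R^-1 ^+ j, y0 + G%:R^-1 ^+ j]%classic; split => //.
    rewrite lebesgue_measure_itv /= lte_fin.
    have gj : 0 < G%:R^-1 ^+ j :> R by rewrite exprn_gt0 ?invr_gt0.
    rewrite ifT; last by lra.
    rewrite -EFinD -EFinM powE lee_fin.
    apply: (@le_trans _ _ (G%:R^-1 ^+ j.+1)).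
      rewrite /c exprS (_ : _ - _ = 2 * G%:R^-1 ^+ j); last by ring.
      by rewrite invfM mulrACA mulVf ?mul1r.
    apply: le_trans (hs j) _; apply: ge0_ler_powR => //; rewrite nnegrE //.
    exact/ltW/hpos.
  move=> y yi Uy /=; rewrite in_itv /= -ler_distl distrC.
  by apply: fd => //; apply: le_lt_trans Dj; rewrite UD.
have mI : measurable (`[0 : R, 1[%classic) by exact: measurable_itv.
have I1 : `[0 : R, 1[%classic `<=` \bigcup_k I k.
  move=> y /=; rewrite in_itv /= => yi; have [k _ Uk] := EU _ (fE y yi).
  by exists k => //; case: (IP k) => _ _; apply.
have le1 : (lebesgue_measure (`[0%R : R, 1%R[%classic : set R)
    <= \sum_(0 <= k <oo) lebesgue_measure (I k))%E.
  by apply: measure_sigma_subadditive => // k; case: (IP k).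
rewrite lebesgue_measure_itv /= lte_fin ltr01 sube0 in le1.
apply: (@le_trans _ _ (c%:E * \sum_(0 <= k <oo) lebesgue_measure (I k))%E).
  by rewrite -[leLHS]mule1; apply: lee_pmul => //; rewrite ?lee_fin ltW.
rewrite -nneseriesZl //; apply: lee_nneseries => k _ //.
  by move=> _; rewrite mule_ge0 // lee_fin ltW.
by case: (IP k).
Unshelve. all: by end_near. Qed.

(** * Lower bound *)

Lemma exp_sumD l m n :
  exp_sum l (m + n) = (exp_sum l m + exp_sum (fun i => l (m + i)%N) n)%N.
Proof. exact: big_split_ord. Qed.

Section Blocks.
Variables (R : realType) (p n : nat) (b : R).
Hypotheses (p_gt1 : (1 < p)%N) (n_gt0 : (0 < n)%N) (b_ge1 : 1 <= b).

Definition cut j : nat := Num.truncn ((j * n)%:R * b).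
Local Notation W := (compositions p n (Num.truncn (n%:R * b))).

(** Raising the first exponent by at most one makes the exponents of the first [j]
    blocks add up to [cut j] exactly, so that the averages converge to [b] also when
    [b] is irrational. *)
Definition block (t : nat -> nat) j : seq (nat * nat) :=
  add_head (cut j.+1 - cut j - Num.truncn (n%:R * b)) (nth [::] W (t j)).

Definition block_seq (t : nat -> nat) k : nat * nat :=
  nth (0, 0)%N (block t (k %/ n)) (k %% n).

Let b_ge0 : 0 <= b. Proof. exact: le_trans b_ge1. Qed.

Lemma cut_itv j : (cut j)%:R <= (j * n)%:R * b < (cut j)%:R + 1.
Proof. by rewrite natr1 truncn_itv // mulr_ge0. Qed.

Lemma cut0 : cut 0 = 0%N.
Proof. by rewrite /cut mul0n mul0r truncn0. Qed.

Lemma cut_ge j : (j <= cut j)%N.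
Proof.
rewrite truncn_ge_nat ?mulr_ge0 // natrM -mulrA ler_peMr //.
by rewrite mulr_ege1 // ler1n.
Qed.

Lemma cutS j : (cut j + Num.truncn (n%:R * b) <= cut j.+1)%N.
Proof.
have [lo _] := andP (cut_itv j).
rewrite truncn_ge_nat ?mulr_ge0 // natrD mulSn natrD mulrDl addrC lerD //.
by have /andP[] : _ <= n%:R * b < _ := truncn_itv (mulr_ge0 (ler0n R n) b_ge0).
Qed.

Section BlockSeq.
Variable t : nat -> nat.
Hypothesis tW : forall j, (t j < size W)%N.

Lemma blockP j :
  [/\ size (block t j) = n, (cut j + word_sum (block t j) = cut j.+1)%N &
      all (ok_letter p) (block t j)].
Proof.
have [sw ww ow] := mem_compositions p_gt1 (mem_nth [::] (tW j)).
rewrite /block size_add_head word_sum_add_head ?sw // ww ok_add_head //.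
by have := cutS j; split=> //; lia.
Qed.

Lemma block_seq_block j i : (i < n)%N ->
  block_seq t (j * n + i) = nth (0, 0)%N (block t j) i.
Proof. by move=> i_n; rewrite /block_seq divnMDl // divn_small // addn0 modnMDl modn_small. Qed.

Lemma ok_block_seq k : ok_letter p (block_seq t k).
Proof.
have [sb _ /all_nthP] := blockP (k %/ n); apply.
by rewrite sb ltn_mod.
Qed.

Lemma exp_sum_block_seq j : exp_sum (block_seq t) (j * n) = cut j.
Proof.
elim: j => [|j IH]; first by rewrite mul0n cut0 /exp_sum big_ord0.
have [sb wb _] := blockP j.
rewrite mulSn addnC exp_sumD IH -wb; congr (_ + _)%N.
rewrite (eq_exp_sum (l' := nth (0, 0)%N (block t j))); last first.
  by move=> i i_n; exact: block_seq_block.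
by rewrite -word_sum_mkseq -{2}(mkseq_nth (0, 0)%N (block t j)) sb.
Qed.

Lemma exp_sum_block_seq_bounds k :
  k%:R * b - (n%:R * b + 1) <= (exp_sum (block_seq t) k)%:R
    <= k%:R * b + n%:R * b.
Proof.
pose j := (k %/ n)%N.
have lo : (j * n <= k)%N by exact: leq_trunc_div.
have hi : (k <= j.+1 * n)%N by rewrite ltnW // ltn_ceil.
have /= := exp_sum_mono (block_seq t) lo; have /= := exp_sum_mono (block_seq t) hi.
rewrite !exp_sum_block_seq -2!(ler_nat R).
have [l1 h1] := andP (cut_itv j); have [l2 h2] := andP (cut_itv j.+1).
move: lo hi; rewrite -2!(ler_nat R) => /(ler_wpM2r b_ge0) lo /(ler_wpM2r b_ge0).
by move: l2 lo h1; rewrite mulSn natrD mulrDl; lra.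
Qed.

(** The sums of exponents differ from [k * b] by a bounded amount, since they are
    monotone and equal to integer parts at the multiples of [n]. *)
Lemma block_seq_average :
  (exp_sum (block_seq t) k.+1)%:R / k%:R @[k --> \oo] --> b.
Proof.
pose c := b + n%:R * b + 1.
have cV : (k%:R^-1 : R) @[k --> \oo] --> 0.
  by rewrite -cvg_shiftS; exact: cvg_harmonic.
have cc e : b + e * k%:R^-1 @[k --> \oo] --> b.
  rewrite -[X in _ --> X]addr0 -[X in _ --> _ + X](mulr0 e).
  by apply: cvgD; [exact: cvg_cst|apply: cvgMr].
apply: (@squeeze_cvgr _ _ _ _ (fun k => b + (- c) * k%:R^-1)
  (fun k => b + c * k%:R^-1)) => //.
near=> k; have k0 : 0 < k%:R :> R by rewrite ltr0n; near: k; exact: nbhs_infty_gt.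
have [lo hi] := andP (exp_sum_block_seq_bounds k.+1).
have nb0 : 0 <= n%:R * b by rewrite mulr_ge0.
rewrite ler_pdivlMr // ler_pdivrMr // !mulrDl !divfK ?gt_eqF //.
by move: b_ge0 lo hi; rewrite /c -[k.+1%:R]natr1; lra.
Unshelve. all: by end_near. Qed.

End BlockSeq.

Lemma block_seq_inj t t' j :
  (forall i, (t i < size W)%N) -> (forall i, (t' i < size W)%N) ->
  (forall k, (k < j * n)%N -> block_seq t k = block_seq t' k) ->
  forall i, (i < j)%N -> t i = t' i.
Proof.
move=> tW tW' tt' i ij; have [sb _ _] := blockP tW i; have [sb' _ _] := blockP tW' i.
have /add_head_inj : block t i = block t' i.
  apply: (@eq_from_nth _ (0, 0)%N); rewrite sb ?sb' // => k kn.
  rewrite -!block_seq_block // tt' //.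
  by apply: leq_trans (_ : i.+1 * n <= _)%N; rewrite ?leq_mul2r ?ij ?orbT // mulSn addnC ltn_add2r.
by move/eqP; rewrite nth_uniq ?compositions_uniq // => /eqP.
Qed.

End Blocks.

Section LowerBound.
Variables (R : realType) (p : nat) (p_pr : prime p).
Local Notation L := (ln (p%:R : R)).
Local Notation q := (p%:R^-1 : R).

(** The [j]-th scale [q ^ cut j] separates the cylinders made of [j] blocks: points
    closer than that share [j] blocks, hence come from reals which share [j] digits.
    The number [G] of blocks is so large that the mass [G ^ - j] of such a cylinder
    is at most the [s]-th power of this scale. *)
Lemma level_set_lower (alpha s : R) : L <= alpha -> 0 <= s -> s < level_dim p alpha ->
  hausdorff_measure (@padic_dist p p_pr R) s (@level_set R p p_pr alpha) <> 0%E.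
Proof.
move=> La s0 sD; have L0 := ln_p_gt0 R p_pr.
have a0 : 0 < alpha by apply: lt_le_trans La.
have p1 := prime_gt1 p_pr.
pose b := alpha / L; have b1 : 1 <= b by rewrite ler_pdivlMr ?mul1r.
have aE : alpha = b * L by rewrite divfK // gt_eqF.
have sa : s * alpha < ln (p%:R - 1) + entropy b.
  by rewrite -(level_dimE p_pr La) ltr_pM2r.
have [n n0 nG] := many_compositions p1 b1 sa.
set W := compositions p n _ in nG; set G := size W in nG.
have G1 : (1 < G)%N.
  have : 0 < ln (G%:R : R) by apply: le_lt_trans nG; rewrite mulr_ge0 // mulr_ge0 // ltW.
  by case: (G) => [|[|g]] //; rewrite ?ln1 ?ln0 ?ltxx.
have dW y j : (digit G y j < size W)%N by exact: digit_lt.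
pose sq (y : R) := block_seq p n b (digit G y).
have sq_ok (y : R) k : ok_letter p (sq y k) by apply: ok_block_seq.
have /choice[f fP] (y : R) : exists x : padic p_pr,
    nonterminating x /\ forall i, letters x i = sq y i.
  by have [x nx xl] := letters_surj R p_pr (sq_ok y); exists x.
have fS y k : exp_sum (letters (f y)) k = exp_sum (sq y) k.
  by apply: eq_exp_sum => i _; case: (fP y) => _ ->.
apply: (@mass_distribution _ _ _ _ f s G (fun j => q ^+ cut n b j)) => //.
- by move=> x y; exact: padic_abs_ge0.
- move=> y _; have [ny _] := fP y; apply/(level_setP _ ny).
  under eq_fun do rewrite fS.
  exact: block_seq_average.
- move=> j y y' yi yi'; rewrite /padic_dist => yy'.
  apply: digits_close => //; apply: (@block_seq_inj R p n b) => // k kj.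
  have [ny ly] := fP y; have [ny' ly'] := fP y'.
  rewrite -/(sq y) -/(sq y') -ly -ly'.
  apply: (close_same_letters (R := R) (n := (j * n)%N)) => //.
  by rewrite fS exp_sum_block_seq.
- by rewrite cut0.
- by move=> j; exact: pinvX_gt0.
- apply: (@squeeze_cvgr _ _ _ _ (fun=> 0) (fun j => q ^+ j)).
  + by near=> j; rewrite ltW ?pinvX_gt0 //= pinvX_le // cut_ge.
  + exact: cvg_cst.
  + by apply: cvg_expr; rewrite ger0_norm ?pinv_ge0 ?pinv_lt1.
move=> j; have G0 : 0 < G%:R :> R by rewrite ltr0n ltnW.
rewrite -ler_ln ?posrE ?powR_gt0 ?exprn_gt0 ?invr_gt0 ?(p_gt0 R p_pr) //.
rewrite ln_powR (ln_pinvX R p_pr) lnXn ?invr_gt0 // lnV ?posrE // mulrN mulNrn lerN2.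
rewrite -[ln _ *+ _]mulr_natl.
have [cj _] := andP (cut_itv n b1 j.+1).
have : (cut n b j.+1)%:R * (s * L) <= (j.+1 * n)%:R * b * (s * L).
  by rewrite ler_wpM2r // mulr_ge0 // ltW.
have : j.+1%:R * (n%:R * (s * alpha)) <= j.+1%:R * ln (G%:R : R).
  by rewrite ler_wpM2l // ltW.
by rewrite natrM aE; lra.
Unshelve. all: by end_near. Qed.

Lemma hausdorff_dim_level_set (alpha : R) : L <= alpha ->
  hausdorff_dim (@padic_dist p p_pr R) (@level_set R p p_pr alpha)
    = (level_dim p alpha)%:E.
Proof.
move=> La; apply/eqP; rewrite eq_le; apply/andP; split.
  apply/lee_addgt0Pr => e e0; apply: ereal_inf_lbound.
  exists (level_dim p alpha + e) => //=; split.
    by rewrite addr_ge0 ?(level_dim_ge0 p_pr) // ltW.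
  by apply: level_set_upper => //; rewrite ltrDl.
apply: le_ereal_inf_tmp => _ [s /= [s0 Hs] <-].
by rewrite lee_fin leNgt; apply/negP => /(level_set_lower La s0).
Qed.

End LowerBound.


(** * The limit of the dimension at the left end *)

Section SpectrumLimit.
Variable R : realType.

Lemma xlnx_ge (x : R) : 0 < x -> - (2 * Num.sqrt x) <= x * ln x.
Proof.
move=> x0; have s0 : 0 < Num.sqrt x by rewrite sqrtr_gt0.
have sE : Num.sqrt x * Num.sqrt x = x by rewrite -expr2 sqr_sqrtr ?ltW.
move: s0 sE; set y := Num.sqrt x => y0 <-; rewrite lnM ?posrE //.
have : ln y^-1 <= y^-1 by rewrite ltW // ln_sublinear // invr_gt0.
rewrite lnV ?posrE // => /(ler_wpM2l (ltW (mulr_gt0 y0 y0))).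
by rewrite mulfK ?gt_eqF //; lra.
Qed.

Lemma entropy_le (b : R) : 1 < b -> entropy b <= b * ln b + 2 * Num.sqrt (b - 1).
Proof.
by move=> b1; have := @xlnx_ge (b - 1); rewrite subr_gt0 => /(_ b1); rewrite /entropy; lra.
Qed.

Lemma schneider_spectrum_cvg (p : nat) (p_pr : prime p) :
  schneider_spectrum p alpha @[alpha --> (ln (p%:R : R))^'+] -->
    ln (p%:R - 1 : R) / ln p%:R.
Proof.
set L := ln (p%:R : R); have L0 : 0 < L := ln_p_gt0 R p_pr.
have cid : (alpha : R) @[alpha --> L] --> L by exact: cvg_id.
have cV : (alpha^-1 : R) @[alpha --> L] --> L^-1 by apply: cvgV; rewrite ?gt_eqF.
have cb : alpha / L @[alpha --> L] --> (1 : R).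
  by rewrite -[X in _ --> X](divff (lt0r_neq0 L0)); apply: cvgMl.
have clow : ln (p%:R - 1) / alpha @[alpha --> L] --> ln (p%:R - 1 : R) / L.
  exact: cvgMr.
have cln : ln (alpha / L) @[alpha --> L] --> (0 : R).
  by rewrite -(ln1 R); apply: cvg_comp cb _; exact: continuous_ln.
have csqrt : Num.sqrt (alpha / L - 1) @[alpha --> L] --> (0 : R).
  rewrite -(sqrtr0 R) -(subrr 1).
  apply: (cvg_comp _ _ (cvgB cb (cvg_cst (1 : R)))); exact: sqrt_continuous.
have cup : (ln (p%:R - 1) + (alpha / L * ln (alpha / L) + 2 * Num.sqrt (alpha / L - 1)))
    / alpha @[alpha --> L] --> ln (p%:R - 1 : R) / L.
  have := cvgM (cvgD (cvg_cst (ln (p%:R - 1 : R)))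
    (cvgD (cvgM cb cln) (cvgM (cvg_cst (2 : R)) csqrt))) cV.
  by rewrite !mulr0 !addr0; apply.
apply: (squeeze_cvgr _ (cvg_at_right_filter clow) (cvg_at_right_filter cup)).
near=> alpha.
have La : L < alpha by near: alpha; exact: nbhs_right_gt.
have a0 : 0 < alpha by apply: lt_trans La.
have b1 : 1 < alpha / L by rewrite ltr_pdivlMr ?mul1r.
have := level_dimE p_pr (ltW La); rewrite /level_dim gt_eqF // => sE.
rewrite ler_pdivrMr // ler_pdivlMr // sE lerDl (entropy_ge0 (ltW b1)) lerD2l.
exact: entropy_le.
Unshelve. all: by end_near. Qed.

End SpectrumLimit.

Theorem corollary1p3 (R : realType) (p : nat) (p_pr : prime p) :
  schneider_spectrum p alpha @[alpha --> (ln (p%:R : R))^'+] -->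
    ln (p%:R - 1 : R) / ln p%:R
  /\
  forall alpha : R, ln p%:R <= alpha ->
  hausdorff_dim (@padic_dist p p_pr R)
    [set x : padic p_pr |
      (@padic_max_ideal p p_pr `\` @schneider_finite p p_pr) x /\
      (fun n : nat => n%:R^-1 * ln (padic_abs R (x - schneider_approx n x)))
        @ \oo --> - alpha]
  = (if alpha == ln p%:R then ln (p%:R - 1) / ln p%:R
     else schneider_spectrum p alpha)%:E.
Proof.
split; first exact: schneider_spectrum_cvg.
exact: hausdorff_dim_level_set.
Qed.
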